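(* Let $T$ be an arbitrary set and let $\mathcal{F}(T)$ be the set of finite subsets of $T$. (a) A function $\theta:\mathcal{F}(T)\to\mathbb{R}$ is the extremal coefficient function (ECF) of a simple max-stable process on $T$ if and only if the following conditions are satisfied: (i) $\theta$ is negative definite; (ii) $\theta(\varnothing)=0$; (iii) $\theta(\{t\})=1$ for all $t\in T$. (b) Suppose $\theta:\mathcal{F}(T)\to\mathbb{R}$ satisfies (i)–(iii). For all $M\in\mathcal{F}(T)\setminus\{\varnothing\}$ and $\varnothing\neq L=\{t_1,\ldots,t_l\}\subset M$ (with $t_1,\dots,t_l$ distinct) put $$\tau^M_L:=-\Delta_{\{t_1\}}\cdots\Delta_{\{t_l\}}\theta(M\setminus L)=\sum_{I\subset L}(-1)^{|I|+1}\theta\bigl((M\setminus L)\cup I\bigr).$$ Then the family of finite-dimensional spectral measures $$H^*_M:=\sum_{\varnothing\neq L\subset M}\tau^M_L\,\|\mathbf{1}_L\|\,\delta_{\mathbf{1}_L/\|\mathbf{1}_L\|},\qquad M\in\mathcal{F}(T)\setminus\{\varnothing\},$$ defines a simple max-stable process $X^*=\{X^*_t\}_{t\in T}$ on $T$, i.e. there is a simple max-stable process with $$-\log\mathbb{P}(X^*_t\le x_t,\ t\in M)=\sum_{\varnothing\neq L\subset M}\tau^M_L\bigvee_{t\in L}\frac1{x_t},\qquad x\in(0,\infty)^M,\ M\in\mathcal{F}(T)\setminus\{\varnothing\},$$ and the ECF of $X^*$ is equal to $\theta$.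
   Context: Simple max-stable process: a real-valued stochastic process $X=\{X_t\}_{t\in T}$ with $\mathbb{P}(X_t\le x)=e^{-1/x}$ for all $t\in T$, $x>0$ (standard Fréchet marginals), such that for every $n\in\mathbb{N}$ and independent copies $X^{(1)},\dots,X^{(n)}$ of $X$ the process $\{\bigvee_{i=1}^nX^{(i)}_t\}_{t\in T}$ has the same law (finite-dimensional distributions) as $\{nX_t\}_{t\in T}$. Extremal coefficient function (ECF) of a simple max-stable process $X$: the function $\theta:\mathcal{F}(T)\to[0,\infty)$ with $\theta(\varnothing)=0$ and, for non-empty finite $A\subset T$, $\theta(A)=\log\mathbb{P}(\bigvee_{t\in A}X_t\le x)/\log(e^{-1/x})=-x\log\mathbb{P}(\bigvee_{t\in A}X_t\le x)$, which does not depend on $x>0$. Negative definite: $\psi:\mathcal{F}(T)\to\mathbb{R}$ is negative definite (in the semigroup sense, for the semigroup $(\mathcal{F}(T),\cup,\varnothing)$) if for all $n\ge2$, $\{K_1,\dots,K_n\}\subset\mathcal{F}(T)$ and $a_1,\dots,a_n\in\mathbb{R}$ with $\sum_ja_j=0$ one has $\sum_{j,k=1}^na_ja_k\psi(K_j\cup K_k)\le0$. For $f:\mathcal{F}(T)\to\mathbb{R}$ and $K,L\in\mathcal{F}(T)$: $(\Delta_Kf)(L):=f(L)-f(L\cup K)$. Spectral measure: for non-empty finite $M\subset T$ and a fixed reference norm $\|\cdot\|$ on $\mathbb{R}^M$, let $S_M=\{a\in[0,\infty)^M:\|a\|=1\}$; $\mathbf{1}_L$ is the indicator function of $L\subset M$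 as an element of $\mathbb{R}^M$, and $\delta_a$ is the Dirac measure at $a$. The finite-dimensional spectral measure of $\{X_t\}_{t\in M}$ is the Radon measure $H_M$ on $S_M$ with $-\log\mathbb{P}(X_t\le x_t,t\in M)=\int_{S_M}\bigl(\bigvee_{t\in M}a_t/x_t\bigr)H_M(\mathrm{d}a)$ for $x\in(0,\infty)^M$. *)

(* Defs.v *)
From HB Require Import structures.
From mathcomp Require Export all_boot all_order all_algebra finmap.
From mathcomp Require Export all_classical all_reals all_analysis.

Set Implicit Arguments.
Unset Strict Implicit.
Unset Printing Implicit Defensive.

Import Order.TTheory GRing.Theory Num.Theory.
Import numFieldNormedType.Exports.

Local Open Scope classical_set_scope.
Local Open Scope ring_scope.

Section processes.
Context {R : realType} {T : choiceType}.

(* Equality of finite-dimensional distributions, as measures on the product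
   sigma-algebra of R^k; X and Y may live on different probability spaces. *)
Definition same_law d d' (Om : measurableType d) (Om' : measurableType d')
    (P : probability Om R) (X : T -> Om -> R)
    (P' : probability Om' R) (Y : T -> Om' -> R) : Prop :=
  forall (k : nat) (t : k.-tuple T) (B : set (k.-tuple R)), measurable B ->
    P [set w | B [tuple X (tnth t i) w | i < k]] =
    P' [set w | B [tuple Y (tnth t i) w | i < k]].

Definition process_sigma d (Om : measurableType d) (X : T -> Om -> R) :
    set (set Om) :=
  <<s [set A | exists t (B : set R), measurable B /\ A = X t @^-1` B] >>.

Definition independent_processes d (Om : measurableType d)
    (P : probability Om R) (n : nat) (Y : 'I_n -> T -> Om -> R) : Prop :=
  forall (J : {set 'I_n}) (E : 'I_n -> set Om),
    (forall i, i \in J -> process_sigma (Y i) (E i)) ->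
    P (\bigcap_(i in [set` J]) E i) = (\prod_(i in J) P (E i))%E.

(* The number of copies is n.+1, so that it ranges over the positive integers;
   the default value of the maximum is one of its terms. *)
Definition simple_max_stable d (Om : measurableType d) (P : probability Om R)
    (X : T -> {RV P >-> R}) : Prop :=
  (forall t (x : R), 0 < x -> cdf (X t) x = (expR (- x^-1))%:E) /\
  (forall (n : nat) d' (Om' : measurableType d') (P' : probability Om' R)
      (Y : 'I_n.+1 -> T -> {RV P' >-> R}),
    (forall i, same_law P' (Y i) P X) ->
    independent_processes P' (fun i t => Y i t) ->
    same_law P' (fun t w => \big[Num.max/Y ord0 t w]_(i < n.+1) Y i t w)
             P (fun t w => n.+1%:R * X t w)).

(* Requiring the formula at every x > 0 includes its independence of x;
   lne is the extended-real logarithm, with lne 0 = -oo. *)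
Definition is_ECF d (Om : measurableType d) (P : probability Om R)
    (X : T -> {RV P >-> R}) (theta : {fset T} -> R) : Prop :=
  theta fset0 = 0 /\
  forall (A : {fset T}) (x : R), A != fset0 -> 0 < x ->
    ((theta A)%:E =
     - (x%:E * lne (P [set w |
                  \big[maxe/-oo]_(t <- A) (X t w)%:E <= x%:E])))%E.

Definition negative_definite (psi : {fset T} -> R) : Prop :=
  forall (n : nat) (K : 'I_n -> {fset T}) (a : 'I_n -> R), (2 <= n)%N ->
    \sum_(j < n) a j = 0 ->
    \sum_(j < n) \sum_(k < n) a j * a k * psi (K j `|` K k)%fset <= 0.

Definition Delta (K : {fset T}) (f : {fset T} -> R) : {fset T} -> R :=
  fun L => f L - f (L `|` K)%fset.

Definition Delta_seq (s : seq T) (f : {fset T} -> R) : {fset T} -> R :=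
  foldr (fun t => Delta [fset t]%fset) f s.

(* L coerces to a duplicate-free enumeration of its elements. *)
Definition tau (theta : {fset T} -> R) (M L : {fset T}) : R :=
  - Delta_seq L theta (M `\` L)%fset.

(* R^M, with the product topology and its Borel sigma-algebra *)
Definition RM (M : {fset T}) := g_sigma_algebraType (@open {ptws M -> R}).

Definition is_norm (M : {fset T}) (N : (M -> R) -> R) : Prop :=
  [/\ forall a, 0 <= N a,
      forall a, N a = 0 -> forall t, a t = 0,
      forall (c : R) a, N (fun t => c * a t) = `|c| * N a &
      forall a b, N (fun t => a t + b t) <= N a + N b].

Definition nneg_sphere (M : {fset T}) (N : (M -> R) -> R) : set (RM M) :=
  [set a : RM M | (forall t, 0 <= a t) /\ N a = 1].

(* A measure on the sphere is encoded as a measure on R^M that does not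
   charge its complement; a finite Borel measure on this compact metrizable
   set is Radon. *)
Definition is_spectral_measure d (Om : measurableType d)
    (P : probability Om R) (X : T -> {RV P >-> R})
    (M : {fset T}) (N : (M -> R) -> R)
    (H : {finite_measure set (RM M) -> \bar R}) : Prop :=
  H (~` nneg_sphere N) = 0%E /\
  forall x : M -> R, (forall t, 0 < x t) ->
    (- lne (P [set w | forall t : M, (X (val t) w <= x t)%R]) =
     \int[H]_(a in nneg_sphere N) (\big[Num.max/0]_(t : M) (a t / x t))%R%:E)%E.

Definition indic_vec (M L : {fset T}) : M -> R := fun t => (val t \in L)%:R.

Definition unit_indic (M : {fset T}) (N : (M -> R) -> R) (L : {fset T}) :
    RM M :=
  fun t => indic_vec L t / N (@indic_vec M L).

Definition Hstar (theta : {fset T} -> R) (M : {fset T}) (N : (M -> R) -> R)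
    (B : set (RM M)) : \bar R :=
  (\sum_(L <- fpowerset M | L != fset0)
    (tau theta M L * N (@indic_vec M L))%:E * \d_(unit_indic N L) B)%E.

End processes.

(* Main.v *)
(* Idea.  For finite [M], inclusion-exclusion writes [theta] on subsets of [M] as
   [theta K = \sum_(L meets K) tau M L], and negative definiteness makes
   [tau M L >= 0] for nonempty [L].  The would-be exponent of the process,
   [\sum_L tau M L * \max_(t in L) 1 / x_t], does not depend on the choice of [M],
   and as a function of finitely many events "X_t <= x" it is a nonnegative
   combination of functions [K |-> 1_(S meets K)].  Its exponential [expR (-)] is
   then a nonnegative combination of functions [K |-> 1_(S avoids K)], hence the
   probability that all the bits in [K] are set under a finitely supported law
   on bit configurations.  An ultrafilter limit of these laws is a content on the
   cylinders of the cube of all bits (indexed by [T] times the rationals),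
   sigma-additive by compactness, so it extends to a probability; [X_t] is the
   infimum of the levels whose bit is set.  Max-stability and the spectral
   measures are read off the exponent.  Conversely, for an ECF,
   [expR (- theta K / x)] is the probability of an intersection over [K] of
   events, hence a Gram form, and [theta] is a limit of [x (1 - expR (- theta / x))]. *)
From HB Require Import structures.
From mathcomp Require Import ring lra measurable_realfun.
Require Import Defs.

Set Implicit Arguments.
Unset Strict Implicit.
Unset Printing Implicit Defensive.

Import Order.TTheory GRing.Theory Num.Theory.
Import numFieldNormedType.Exports.

Local Open Scope classical_set_scope.
Local Open Scope ring_scope.

(** * Finite mixtures of bit configurations and their extension *)

Definition cube (I : Type) := I -> bool.

HB.instance Definition _ (I : Type) := gen_eqMixin (cube I).
HB.instance Definition _ (I : Type) := gen_choiceMixin (cube I).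
HB.instance Definition _ (I : Type) := isPointed.Build (cube I) (fun=> false).

(** One implication suffices, because agreement on [J] is symmetric in [f] and [g]. *)
Definition cylinder (I : choiceType) (A : set (cube I)) : Prop :=
  exists J : {fset I}, forall f g, {in J, f =1 g} -> A f -> A g.

Section cylinders.
Context {I : choiceType}.

Lemma cylinder0 : cylinder (@set0 (cube I)).
Proof. by exists fset0. Qed.

Lemma cylinderU : setU_closed (@cylinder I).
Proof.
move=> A B [J AJ] [K BK]; exists (J `|` K)%fset => f g fg [Af|Bf].
- by left; apply: AJ Af => i iJ; apply: fg; rewrite in_fsetU iJ.
- by right; apply: BK Bf => i iK; apply: fg; rewrite in_fsetU iK orbT.
Qed.

Lemma cylinderC : setC_closed (@cylinder I).
Proof.
move=> A [J AJ]; exists J => f g fg nAf Ag; apply: nAf.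
by apply: AJ Ag => i iJ; rewrite fg.
Qed.

HB.instance Definition _ := @isAlgebraOfSets.Build
  default_measure_display (cube I) (@cylinder I) cylinder0 cylinderU cylinderC.

Lemma cylinder_coord (i : I) : cylinder [set f : cube I | f i].
Proof.
by exists [fset i]%fset => f g fg; rewrite /= (fg i)// in_fset1.
Qed.

(* An ultrafilter limit of points of the [C n] exists in the cube and, as each
   cylinder only looks at finitely many coordinates, lies in all of them. *)
Lemma cylinder_compact (C : (set (cube I))^nat) :
  (forall n, cylinder (C n)) -> (forall n, C n.+1 `<=` C n) ->
  (forall n, C n !=set0) -> \bigcap_n C n !=set0.
Proof.
move=> cC dC C0; have [f fC] := choice C0.
have [U [UU oU]] := ultraFilterLemma (@eventually_filter).
have mC m n : (m <= n)%N -> C n `<=` C m.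
  move=> /subnK <-; elim: (n - m)%N => // k IH.
  by rewrite addSn; apply: subset_trans IH; exact: dC.
pose g : cube I := fun i => `[< U [set n | f n i] >].
exists g => m _; have [J CJ] := cC m.
have UJ : forall s : seq I, U [set n | {in s, f n =1 g}].
  elim=> [|i s IH].
    by apply: filterS (@filterT _ U _) => n _ i.
  have Ui : U [set n | f n i = g i].
    have [Ut|Uf] := in_ultra_setVsetC [set n | f n i] UU.
      by apply: (filterS _ Ut) => n /= ->; apply/esym/asboolP; exact: Ut.
    apply: (filterS _ Uf) => n /= /negP/negbTE fni.
    rewrite fni; apply/esym/asboolPn => Ut.
    have : U set0 by apply: filterS (filterI Ut Uf) => k [].
    exact: filter_not_empty.
  apply: filterS (filterI Ui IH) => n [/= e1 e2] j.
  by rewrite inE => /predU1P[->//|/e2].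
have Um : U [set n | (m <= n)%N] by apply: oU; exact: nbhs_infty_ge.
have [n [/= mn fng]] := @filter_ex _ U _ _ (filterI Um (UJ J)).
by apply: CJ fng _; apply: mC mn _ (fC n).
Qed.

End cylinders.

Section mixtures.
Context {R : realType} {I : choiceType}.
Implicit Types (s : seq (R * cube I)) (J K : {fset I}).

(** The list is a finitely supported measure on bit configurations, of total mass [phi fset0]. It
    may depend on [J]. *)
Definition mixture (J : {fset I}) (phi : {fset I} -> R) : Prop :=
  exists2 s : seq (R * cube I), all (fun p => 0 <= p.1) s &
    forall K, (K `<=` J)%fset -> phi K = \sum_(p <- s) p.1 * (all p.2 K)%:R.

Definition mass s (A : set (cube I)) : R := \sum_(p <- s) p.1 * `[< A p.2 >]%:R.

Lemma mass_ge0 s A : all (fun p => 0 <= p.1) s -> 0 <= mass s A.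
Proof.
rewrite /mass; elim: s => [|p s IH]; first by rewrite big_nil.
by move=> /= /andP[p0 s0]; rewrite big_cons addr_ge0 ?IH// mulr_ge0// ler0n.
Qed.

Lemma mass_le s A : all (fun p => 0 <= p.1) s -> mass s A <= mass s setT.
Proof.
rewrite /mass; elim: s => [|p s IH]; first by rewrite !big_nil.
move=> /= /andP[p0 s0]; rewrite !big_cons lerD ?IH// ler_wpM2l//.
by rewrite ler_nat (@asboolT ([set: cube I] p.2))// leq_b1.
Qed.

Lemma mass0 s : mass s set0 = 0.
Proof. by rewrite /mass big1// => p _; rewrite (asboolF (@id False)) mulr0. Qed.

Lemma massU s A B : A `&` B = set0 -> mass s (A `|` B) = mass s A + mass s B.
Proof.
move=> AB; rewrite /mass -big_split/=; apply: eq_bigr => p _.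
rewrite -mulrDr -natrD; congr (_ * _%:R).
have : ~ (A p.2 /\ B p.2) by move=> ABp; have : set0 p.2 by rewrite -AB.
case: (asboolP (A p.2)) => Ap; case: (asboolP (B p.2)) => Bp //=.
- by move=> /(_ (conj Ap Bp)).
- by move=> _; rewrite (asboolT (or_introl Ap : (A `|` B) p.2)).
- by move=> _; rewrite (asboolT (or_intror Bp : (A `|` B) p.2)).
- by move=> _; rewrite asboolF// => -[].
Qed.

(** The image of [U] is an ultrafilter on a compact segment, so it has a cluster point and converges
    to it. *)
Lemma ultra_cvg_bounded (X : Type) (U : set_system X) (UU : UltraFilter U)
    (a : X -> R) (b c : R) :
  U [set x | b <= a x <= c] -> exists l : R, a x @[x --> U] --> l.
Proof.
move=> Ubc.
have UA : (a @ U) `[b, c]%classic.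
  apply: (@filterS _ U _ _ _ _ Ubc) => x /=; by rewrite in_itv.
have [l [_ clu]] := @segment_compact R b c (a @ U) _ UA.
exists l => B lB.
have [//|UnB] := in_ultra_setVsetC (a @^-1` B) UU.
by have [x [/= ? ?]] := clu _ _ (UnB : (a @ U) (~` B)) lB.
Qed.

(* The laws given by the mixtures on different [J] need not be consistent, but
   their limit along an ultrafilter of ever larger [J] is a content giving mass
   [phi K] to the event that all bits of [K] are set. *)
Lemma mixture_extension (phi : {fset I} -> R) :
  phi fset0 = 1 -> (forall J, mixture J phi) ->
  exists (d : measure_display) (Om : measurableType d) (P : probability Om R)
    (bit : I -> set Om), (forall i, measurable (bit i)) /\
    forall K, P [set w | forall i, i \in K -> bit i w] = (phi K)%:E.
Proof.
move=> phi0 phiM.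
have /choice[s sP] : forall J, exists s : seq (R * cube I),
    all (fun p => 0 <= p.1) s /\ forall K, (K `<=` J)%fset ->
      phi K = \sum_(p <- s) p.1 * (all p.2 K)%:R.
  by move=> J; have [s s0 sphi] := phiM J; exists s.
(* Whatever holds for all large enough [J] belongs to [F], hence to the ultrafilter [U] refining
   it. *)
pose F : set_system {fset I} := [set A | exists J0, forall J,
   (J0 `<=` J)%fset -> A J].
have FF : ProperFilter F.
  split; first by move=> [J0 /(_ J0 (fsubset_refl _))].
  split.
  - by exists fset0.
  - move=> A B [J AJ] [K BK]; exists (J `|` K)%fset => L; rewrite fsubUset.
    by move=> /andP[JL KL]; split; [exact: AJ|exact: BK].
  - by move=> A B AB [J AJ]; exists J => K /AJ /AB.
have [U [UU FU]] := ultraFilterLemma FF.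
have massT J : mass (s J) setT = 1.
  have [_ /(_ fset0 (fsub0set _))] := sP J; rewrite phi0 => ->.
  by apply: eq_bigr => p _; rewrite asboolT.
have /choice[m mP] : forall A, exists l : R, mass (s J) A @[J --> U] --> l.
  move=> A; apply: (@ultra_cvg_bounded _ U UU _ 0 1); apply: FU; exists fset0.
  by move=> J _ /=; rewrite mass_ge0 ?(sP J).1//= -(massT J) mass_le ?(sP J).1.
have m_unique A l : mass (s J) A @[J --> U] --> l -> m A = l.
  by move=> Al; have /cvg_unique := mP A; apply.
have mU A B : A `&` B = set0 -> m (A `|` B) = m A + m B.
  move=> AB; apply: m_unique; under eq_fun do rewrite (massU _ AB).
  by apply: cvgD; exact: mP.
have m0 : m set0 = 0.
  by apply: m_unique; under eq_fun do rewrite mass0; exact: cvg_cst.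
have m_ge0 A : 0 <= m A.
  apply: (cvgr_to_ge (mP A)).
  by apply: FU; exists fset0 => J _; rewrite /= mass_ge0// (sP J).1.
pose mu : set (cube I) -> \bar R := fun A => (m A)%:E.
have mu0 : mu set0 = 0%E by rewrite /mu m0.
have mu_ge0 A : (0 <= mu A)%E by rewrite lee_fin.
have m_bigU (A : (set (cube I))^nat) n : trivIset setT A ->
    m (\bigcup_(i in `I_n) A i) = \sum_(i < n) m (A i).
  move=> tA; elim: n => [|n IH]; first by rewrite II0 bigcup_set0 big_ord0.
  rewrite big_ord_recr/= -IH IIS bigcup_setU bigcup_set1 mU//.
  rewrite setI_bigcupl bigcup0// => i/= ltin.
  by have /trivIsetP/(_ i n Logic.I Logic.I) := tA; apply; rewrite neq_ltn ltin.
(* The remainders [C n] are decreasing cylinders with empty intersection, so by compactness one of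
   them is empty and finite additivity is enough. *)
have mu_sigma : semi_sigma_additive mu.
  move=> A cA tA cUA.
  pose C n := \bigcup_i A i `\` \bigcup_(i in `I_n) A i.
  have cC n : cylinder (C n).
    apply: (@measurableD _ (cube I)) => //.
    exact: (@fin_bigcup_measurable _ (cube I)).
  have [n Cn0] : exists n, C n = set0.
    apply: contrapT => /forallNP C0.
    have [] := cylinder_compact cC.
    - by move=> n f [UAf nAf]; split=> // -[i ltin Aif]; apply: nAf; exists i;
        [exact: (ltnW ltin)|].
    - by move=> n; apply/set0P/eqP; exact: C0.
    - move=> f Cf; have [[i _ Aif] _] := Cf 0%N Logic.I.
      have [_] := Cf i.+1 Logic.I; apply; exists i => //=; exact: ltnSn.
  apply: cvg_near_cst; exists n => // N /= nN.
  rewrite /mu sumEFin big_mkord -m_bigU//; congr (m _)%:E.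
  apply/seteqP; split=> [f [i _ Aif]|f UAf]; first by exists i.
  apply: contrapT => nAf; suff : C n f by rewrite Cn0.
  by split=> // -[i ltin Aif]; apply: nAf; exists i => //; exact: leq_trans nN.
pose mu' : {measure set (cube I) -> \bar R} := HB.pack mu
  (isMeasure.Build _ _ _ mu mu0 mu_ge0 mu_sigma).
pose P0 : {measure set (g_sigma_algebraType (@measurable _ (cube I))) -> \bar R} :=
  measure_extension mu'.
have P0E A : cylinder A -> P0 A = (m A)%:E.
  by move=> cA; exact: (measurable_mu_extE mu').
have P0T : P0 setT = 1%E.
  rewrite P0E; last exact: (@measurableT _ (cube I)).
  by congr _%:E; apply: m_unique; under eq_fun do rewrite massT; exact: cvg_cst.
pose P : probability _ R := HB.pack (P0 : set _ -> \bar R) (Measure.class P0)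
  (Measure_isProbability.Build _ _ _ P0 P0T).
exists _, _, P, (fun i => [set f : cube I | f i]); split.
  by move=> i; apply: sub_gen_smallest; exact: cylinder_coord.
move=> K; rewrite [LHS]P0E; last by exists K => f g fg fK i iK; rewrite /= -(fg i iK) fK.
(* The masses need not stabilise in general, but this one equals [phi K] as soon as [J] contains
   [K]. *)
congr _%:E; apply: m_unique; apply: cvg_near_cst; apply: FU; exists K => J KJ.
rewrite /mass (sP J).2//; apply: eq_bigr => p _; congr (_ * (nat_of_bool _)%:R).
by apply/asboolP/allP.
Qed.
End mixtures.

(** * Alternating sums *)

Section alternating_sums.
Context {R : realType} {T : choiceType}.
Implicit Types (f g theta : {fset T} -> R) (A L M I J : {fset T}) (t : T).

Lemma big_fpowersetU1 (F : {fset T} -> R) t L : t \notin L ->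
  \sum_(I <- fpowerset (t |` L)%fset) F I =
  \sum_(I <- fpowerset L) (F I + F (t |` I)%fset).
Proof.
move=> tL; rewrite big_split/= -(big_map (fun I => t |` I)%fset xpredT F) -big_cat/=.
apply: perm_big; apply: uniq_perm; first exact: fset_uniq.
  rewrite cat_uniq fset_uniq/=; apply/andP; split.
    apply/hasPn => _ /mapP[I _ ->]; rewrite fpowersetE.
    by apply: contra tL => /fsubsetP; apply; rewrite fset1U1.
  rewrite map_inj_in_uniq ?fset_uniq// => I J.
  rewrite !fpowersetE => /fsubsetP IL /fsubsetP JL /fsetP e; apply/fsetP => x.
  have := e x; rewrite !in_fset1U; case: eqP => [->|]//= _.
  by rewrite (contraNF (IL t))// (contraNF (JL t)).
move=> I; rewrite mem_cat !fpowersetE; apply/idP/idP => [ItL|].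
  have [tI|tI] := boolP (t \in I).
    apply/orP; right; apply/mapP; exists (I `\ t)%fset; last by rewrite fsetD1K.
    by rewrite fpowersetE fsubDset.
  apply/orP; left; apply/fsubsetP => x xI.
  have := fsubsetP ItL x xI; rewrite in_fset1U => /predU1P[xt|//].
  by rewrite -xt xI in tI.
move=> /orP[IL|/mapP[J]]; first exact: fsubset_trans IL (fsubsetUr _ _).
by rewrite fpowersetE => JL ->; exact: fsetUS.
Qed.

(** The iterated difference of [f] at [A] along [L], expanded so that the order of the elements no
    longer matters. *)
Definition alt_sum f A L : R :=
  \sum_(I <- fpowerset L) (-1) ^+ #|` I|%fset * f (A `|` I)%fset.

Lemma alt_sum0 f A : alt_sum f A fset0 = f A.
Proof.
by rewrite /alt_sum fpowerset0 big_seq_fset1 cardfs0 expr0 mul1r fsetU0.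
Qed.

Lemma card_fset1U_sign t I : t \notin I ->
  (-1) ^+ #|` t |` I|%fset = - (-1) ^+ #|` I|%fset :> R.
Proof. by move=> tI; rewrite cardfsU1 tI exprS mulN1r. Qed.

Lemma notin_fpowerset t L I : t \notin L -> I \in fpowerset L -> t \notin I.
Proof. by move=> tL; rewrite fpowersetE => /fsubsetP IL; exact: contra (IL t) tL. Qed.

Lemma alt_sumU1 f A t L : t \notin L ->
  alt_sum f A (t |` L)%fset = alt_sum f A L - alt_sum f (A `|` [fset t])%fset L.
Proof.
move=> tL; rewrite /alt_sum big_fpowersetU1// -sumrN -big_split/=.
apply: eq_big_seq => I /(notin_fpowerset tL) tI.
by rewrite card_fset1U_sign// mulNr fsetUA.
Qed.

Lemma Delta_seqE s f A : uniq s ->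
  Delta_seq s f A = alt_sum f A [fset x in s]%fset.
Proof.
elim: s A => [|t s IH] A /=.
  move=> _; rewrite (_ : [fset x in [::]]%fset = fset0) ?alt_sum0//.
  by apply/fsetP => x; rewrite !inE.
move=> /andP[ts us]; rewrite fset_cons alt_sumU1 ?inE//.
by rewrite /Delta !IH.
Qed.

Lemma tauE theta M L : tau theta M L = - alt_sum theta (M `\` L)%fset L.
Proof.
rewrite /tau Delta_seqE ?fset_uniq//; congr (- alt_sum _ _ _).
by apply/fsetP => x; rewrite inE.
Qed.

(** A subset of the enlarged ground set with trace [L] on [M] is [L] with or without [t]; by the
    recursion [alt_sumU1] the two weights telescope. *)
Lemma tau_consistent1 theta M L t : t \notin M -> (L `<=` M)%fset ->
  tau theta (t |` M)%fset L + tau theta (t |` M)%fset (t |` L)%fset =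
  tau theta M L.
Proof.
move=> tM LM; have tL : t \notin L by apply: contra tM => /(fsubsetP LM).
rewrite !tauE alt_sumU1//.
have -> : ((t |` M) `\` L = (M `\` L) `|` [fset t])%fset.
  apply/fsetP => x; rewrite !inE; case: eqP => [->|_]; last by rewrite orbF.
  by rewrite tL orbT.
have -> : ((t |` M) `\` (t |` L) = M `\` L)%fset.
  apply/fsetP => x; rewrite !inE; case: eqP => [->|_] //=.
  by rewrite (negbTE tM) andbF.
by rewrite opprB addKr.
Qed.

(** Consistency in the ground set: taking traces on [M] maps the weights of the larger set to those
    of [M], one point of [N] at a time. The empty set is included, with weight minus the value of
    [theta] at the ground set. *)
Lemma tau_marginal theta M N (F : {fset T} -> R) :
  \sum_(L <- fpowerset (M `|` N)%fset) tau theta (M `|` N)%fset L * F (L `&` M)%fset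
  = \sum_(L <- fpowerset M) tau theta M L * F L.
Proof.
elim/finSet_rect: N => N IH.
have [->|[t tN]] := fset_0Vmem N.
  rewrite fsetU0; apply: eq_big_seq => L; rewrite fpowersetE => /fsetIidPl.
  by move=> ->.
have NE : N = (t |` N `\ t)%fset by rewrite fsetD1K.
have /IH {IH}IH : (N `\ t `<` N)%fset by rewrite fproperD1.
have [tM|tM] := boolP (t \in M).
  have -> // : (M `|` N = M `|` (N `\ t))%fset.
  by apply/fsetP => x; rewrite !inE; case: eqP => [->|]//=; rewrite tM.
have MNE : (M `|` N = t |` (M `|` (N `\ t)))%fset by rewrite fsetUCA -NE.
have tMN : t \notin (M `|` (N `\ t))%fset by rewrite !inE (negbTE tM) eqxx.
rewrite MNE big_fpowersetU1// -IH; apply: eq_big_seq => L.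
rewrite fpowersetE => LMN.
have -> : ((t |` L) `&` M = L `&` M)%fset.
  apply/fsetP => x; rewrite !inE; case: eqP => [->|]//=.
  by rewrite (negbTE tM) !andbF.
by rewrite -mulrDl tau_consistent1.
Qed.

(** Traces on the empty set show that all weights add up to [- theta fset0], that is 0, and the
    empty set alone has weight [- theta M]. *)
Lemma sum_tau theta M : theta fset0 = 0 ->
  \sum_(L <- fpowerset M | L != fset0) tau theta M L = theta M.
Proof.
move=> theta0; have := tau_marginal theta fset0 M (fun=> 1).
rewrite fset0U fpowerset0 big_seq_fset1 mulr1 tauE alt_sum0 fsetD0 theta0 oppr0.
under eq_bigr do rewrite mulr1.
rewrite (bigD1_seq fset0) ?fset_uniq ?fpowersetE ?fsub0set//=.
by rewrite tauE alt_sum0 fsetD0 addrC => /subr0_eq.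
Qed.

(** Induction on [L]: a new [t] lies in neither, one or both of [I] and [J]. The last three cases
    have the same union and signs -, -, +, which leave one minus sign, as in [alt_sumU1]. *)
Lemma alt_sum_idem f A L :
  \sum_(I <- fpowerset L) \sum_(J <- fpowerset L)
    (-1) ^+ #|` I|%fset * (-1) ^+ #|` J|%fset * f (A `|` (I `|` J))%fset =
  alt_sum f A L.
Proof.
elim/finSet_rect: L A => L IH A.
have [->|[t tL]] := fset_0Vmem L.
  rewrite alt_sum0 fpowerset0 !big_seq_fset1.
  by rewrite cardfs0 expr0 !mul1r !fsetU0.
have LE : L = (t |` L `\ t)%fset by rewrite fsetD1K.
have /IH {}IH : (L `\ t `<` L)%fset by rewrite fproperD1.
have tLt : t \notin (L `\ t)%fset by rewrite !inE eqxx.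
rewrite {1 2 3}LE alt_sumU1// -!IH big_fpowersetU1// -sumrN -big_split/=.
apply: eq_big_seq => I /(notin_fpowerset tLt) tI.
rewrite !big_fpowersetU1// -sumrN -!big_split/=.
apply: eq_big_seq => J /(notin_fpowerset tLt) tJ.
rewrite !card_fset1U_sign//.
set a := _ ^+ _; set b := _ ^+ _.
have -> : (A `|` (I `|` (t |` J)) = A `|` [fset t] `|` (I `|` J))%fset.
  by rewrite (fsetUCA I) fsetUA.
have -> : (A `|` (t |` I `|` J) = A `|` [fset t] `|` (I `|` J))%fset.
  by rewrite -fsetUA fsetUA.
have -> : (A `|` (t |` I `|` (t |` J)) = A `|` [fset t] `|` (I `|` J))%fset.
  by rewrite fsetUACA fsetUid fsetUA.
by ring.
Qed.

Lemma alt_sum_cst c A L : L != fset0 -> alt_sum (fun=> c) A L = 0.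
Proof.
move=> /fset0Pn[t tL]; rewrite -(fsetD1K tL) alt_sumU1 ?subrr//.
by rewrite !inE eqxx.
Qed.

(* The signs [(-1)^|I|], [I] a subset of [L], are the test vector: by
   [alt_sum_idem] its quadratic form is a single alternating sum. *)
Lemma tau_ge0 theta M L : negative_definite theta -> L != fset0 ->
  0 <= tau theta M L.
Proof.
move=> ndt L0; rewrite tauE oppr_ge0 -alt_sum_idem.
have := ndt (size (fpowerset L))
  (fun i => (M `\` L `|` tnth (in_tuple (fpowerset L)) i)%fset)
  (fun i => (-1) ^+ #|` tnth (in_tuple (fpowerset L)) i|%fset).
rewrite -(big_tnth _ _ (fpowerset L) xpredT (fun I => (-1) ^+ #|` I|%fset)).
have card2 : (2 <= size (fpowerset L))%N.
  rewrite -[size _]/(#|` fpowerset L|%fset) card_fpowerset.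
  by rewrite -[2%N]/(2 ^ 1)%N leq_exp2l// cardfs_gt0.
have sign0 : \sum_(I <- fpowerset L) (-1) ^+ #|` I|%fset = 0 :> R.
  rewrite -[RHS](alt_sum_cst 1 fset0 L0); apply: eq_bigr => I _.
  by rewrite mulr1.
move=> /(_ card2 sign0); congr (_ <= _); rewrite [RHS]big_tnth.
apply: eq_bigr => i _; rewrite [RHS]big_tnth; apply: eq_bigr => j _.
by rewrite fsetUACA fsetUid.
Qed.

Lemma tau_alt_sumE theta M L s : uniq s -> s =i L ->
  tau theta M L = - Delta_seq s theta (M `\` L)%fset /\
  tau theta M L = \sum_(I <- fpowerset L)
    (-1) ^+ (#|` I|%fset).+1 * theta ((M `\` L) `|` I)%fset.
Proof.
move=> us sL; rewrite tauE Delta_seqE//; split.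
  by congr (- alt_sum _ _ _); apply/fsetP => x; rewrite inE sL.
by rewrite -sumrN; apply: eq_bigr => I _; rewrite exprS mulN1r mulNr.
Qed.

End alternating_sums.

(** * Closure properties of mixtures and exponentials of alternating functions *)

Section mixture_theory.
Context {R : realType} {I : choiceType}.
Implicit Types (s : seq (R * cube I)) (J K : {fset I}) (phi : {fset I} -> R).

Lemma eq_mixture J phi1 phi2 : (forall K, (K `<=` J)%fset -> phi1 K = phi2 K) ->
  mixture J phi1 -> mixture J phi2.
Proof. by move=> e [s s0 sP]; exists s => // K KJ; rewrite -e// sP. Qed.

(** The product law: take the coordinatewise conjunction of two independent configurations. *)
Lemma mixtureM J phi1 phi2 :
  mixture J phi1 -> mixture J phi2 -> mixture J (fun K => phi1 K * phi2 K).
Proof.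
move=> [s1 s10 s1P] [s2 s20 s2P].
exists [seq (p.1 * q.1, (fun i => p.2 i && q.2 i) : cube I) | p <- s1, q <- s2].
  apply/allP => _ /allpairsP[[p q] [/= ps qs ->]] /=.
  by apply: mulr_ge0; [move/allP: s10; apply|move/allP: s20; apply].
move=> K KJ; rewrite s1P// s2P// big_allpairs_dep mulr_suml.
apply: eq_bigr => p _; rewrite mulr_sumr; apply: eq_bigr => q _ /=.
by rewrite (all_predI p.2 q.2) -mulnb natrM mulrACA.
Qed.

(** Each term is the indicator that [K] meets the set where [p.2] is false: a finite form of
    complete alternation, normalised to vanish at the empty set. *)
Definition alternating (J : {fset I}) (psi : {fset I} -> R) : Prop :=
  exists2 s : seq (R * cube I), all (fun p => 0 <= p.1) s &
    forall K, (K `<=` J)%fset ->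
      psi K = \sum_(p <- s) p.1 * (~~ all p.2 K)%:R.

Lemma eq_alternating J psi1 psi2 :
  (forall K, (K `<=` J)%fset -> psi1 K = psi2 K) ->
  alternating J psi1 -> alternating J psi2.
Proof. by move=> e [s s0 sP]; exists s => // K KJ; rewrite -e// sP. Qed.

Lemma alternating0 J : alternating J (fun=> 0).
Proof. by exists [::] => // K _; rewrite big_nil. Qed.

Lemma alternating1 J (f : cube I) (c : R) : 0 <= c ->
  alternating J (fun K => c * (~~ all f K)%:R).
Proof.
by move=> c0; exists [:: (c, f)] => /= [|K _]; rewrite ?c0// big_seq1.
Qed.

Lemma alternatingD J psi1 psi2 : alternating J psi1 -> alternating J psi2 ->
  alternating J (fun K => psi1 K + psi2 K).
Proof.
move=> [s1 s10 s1P] [s2 s20 s2P]; exists (s1 ++ s2); first by rewrite all_cat s10.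
by move=> K KJ; rewrite big_cat s1P// s2P.
Qed.

Lemma alternatingZ J psi c : 0 <= c -> alternating J psi ->
  alternating J (fun K => c * psi K).
Proof.
move=> c0 [s s0 sP]; exists [seq (c * p.1, p.2) | p <- s].
  apply/allP => _ /mapP[p ps ->] /=; rewrite mulr_ge0//.
  by move/allP: s0; apply.
move=> K KJ; rewrite big_map sP// mulr_sumr; apply: eq_bigr => p _.
by rewrite mulrA.
Qed.

Lemma alternating_sum (X : eqType) J (r : seq X) (psi : X -> {fset I} -> R) :
  {in r, forall x, alternating J (psi x)} ->
  alternating J (fun K => \sum_(x <- r) psi x K).
Proof.
elim: r => [|x r IH] rP.
  by apply: eq_alternating (alternating0 J) => K _; rewrite big_nil.
have IHr : alternating J (fun K => \sum_(x <- r) psi x K).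
  by apply: IH => y yr; apply: rP; rewrite inE yr orbT.
apply: eq_alternating (alternatingD (rP x (mem_head _ _)) IHr) => K _.
by rewrite big_cons.
Qed.

(** The exponential of a sum is a product, so one term suffices. A term of weight [c] gives a
    two-point law: the all-true configuration with mass [expR (- c)], the given one with mass
    [1 - expR (- c)]. *)
Lemma mixture_exp J psi : alternating J psi ->
  mixture J (fun K => expR (- psi K)).
Proof.
move=> [s s0 sP].
suff : mixture J (fun K => expR (- \sum_(p <- s) p.1 * (~~ all p.2 K)%:R)).
  by apply: eq_mixture => K KJ; rewrite sP.
elim: s s0 {sP} => [_|p s IH /= /andP[p0 s0]].
  exists [:: (1, (fun=> true) : cube I)] => /= [|K _]; first by rewrite ler01.
  by rewrite big_nil oppr0 expR0 big_seq1/= all_predT mulr1.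
have pM : mixture J (fun K => expR (- (p.1 * (~~ all p.2 K)%:R))).
  exists [:: (expR (- p.1), (fun=> true) : cube I); (1 - expR (- p.1), p.2)].
    by rewrite /= expR_ge0 subr_ge0 -expR0 ler_expR oppr_le0 p0.
  move=> K _; rewrite big_cons big_seq1/= all_predT mulr1.
  by case: (all _ _) => /=; rewrite ?mulr0 ?mulr1 ?oppr0 ?expR0 ?addr0// subrKC.
apply: eq_mixture (mixtureM pM (IH s0)) => K _.
by rewrite -expRD big_cons opprD.
Qed.

(* Layer-cake: peel off the smallest positive value. *)
Lemma alternating_max J (y : I -> R) :
  alternating J (fun K => \big[Num.max/0]_(k <- K) y k).
Proof.
have [n] := ubnP #|[pred k : J | 0 < y (val k)]|.
elim: n y => // n IH y; rewrite ltnS => yn.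
have [k0 yk0|y0] := pickP [pred k : J | 0 < y (val k)]; last first.
  apply: eq_alternating (alternating0 J) => K /fsubsetP KJ.
  apply/esym/eqP; rewrite big_seq eq_le bigmax_ge_id andbT.
  apply: bigmax_le => // k kK.
  by rewrite leNgt; have := y0 [` KJ _ kK]%fset; rewrite inE => ->.
case: (@arg_minP _ _ _ k0 [pred k : J | 0 < y (val k)] (fun k => y (val k)) yk0).
move=> k1 /= yk1 ymin; set m := y (val k1) in yk1 ymin.
(* Lowering by the smallest positive value [m] removes [k1] from the positive entries and creates no
   new ones. *)
pose y' k := Num.max 0 (y k - m).
have y'n : (#|[pred k : J | (0 < y' (val k))%R]| < n)%N.
  apply: leq_trans yn; apply/proper_card/properP; split.
    apply/fintype.subsetP => k; rewrite !inE /y' lt_max ltxx/= subr_gt0.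
    exact: lt_trans.
  by exists k1; rewrite !inE//= /y' subrr maxxx ltxx.
apply: eq_alternating (alternatingD
  (alternating1 J (fun k => ~~ (0 < y k)) (ltW yk1)) (IH _ y'n)).
move=> K /fsubsetP KJ.
(* The second conjunct carries the list induction: when the first positive entry brings in the term
   [m], the lowered maximum of the rest must be 0. *)
suff core (s : seq I) : {subset s <= J} ->
  m * (~~ all (fun k => ~~ (0 < y k)) s)%:R + \big[Num.max/0]_(k <- s) y' k
  = \big[Num.max/0]_(k <- s) y k /\
  (all (fun k => ~~ (0 < y k)) s -> \big[Num.max/0]_(k <- s) y' k = 0).
  exact: (core K KJ).1.
elim: s => [|k s IHs] sJ; first by rewrite !big_nil/= mulr0 addr0.
have {IHs} [|e1 e2] := IHs; first by move=> i si; apply: sJ; rewrite inE si orbT.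
have kJ : k \in J by apply: sJ; rewrite mem_head.
have ym : 0 < y k -> m <= y k by move=> yk; exact: (ymin [` kJ]%fset).
have S0 : 0 <= \big[Num.max/0]_(k <- s) y' k by exact: bigmax_ge_id.
rewrite !big_cons -e1 [all _ (k :: s)]/= negb_and negbK {e1}.
move: (\big[Num.max/0]_(k <- s) y' k) (all _ s) e2 S0 => S' b e2 S0.
rewrite /y'; have [yk|yk] := ltP 0 (y k); split=> //=.
- rewrite (@max_r _ _ 0) ?subr_ge0 ?ym//.
  case: b e2 => [->//|_] /=; rewrite ?mulr0 ?mulr1 ?add0r ?addr_maxr ?subrKC//.
  by rewrite addr0 !max_l ?ym// ltW.
- rewrite (@max_l _ _ 0) ?(max_r S0); last by lra.
  by rewrite max_r// (le_trans yk)// addr_ge0// mulr_ge0// ltW.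
- move=> /e2 ->; rewrite maxAC maxxx max_l//; lra.
Qed.

End mixture_theory.

(** * The exponent function *)

Section exponent.
Context {R : realType} {T : choiceType}.
Implicit Types (theta : {fset T} -> R) (s : seq (T * R)) (L M : {fset T}).

Definition max_on s L : R := \big[Num.max/0]_(k <- s | k.1 \in L) k.2.

(* An entry [(t, y)] of [s] stands for the event [X_t <= 1 / y]. *)
Definition exponent theta s : R :=
  let M := [fset t in [seq k.1 | k <- s]]%fset in
  \sum_(L <- fpowerset M) tau theta M L * max_on s L.

Lemma max_on_ge0 s L : 0 <= max_on s L.
Proof. exact: bigmax_ge_id. Qed.

Lemma max_on0 s : max_on s fset0 = 0.
Proof. by rewrite /max_on big_pred0. Qed.

Lemma max_on_map (X : eqType) (r : seq X) (v : X -> T * R) L :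
  max_on [seq v k | k <- r] L =
  \big[Num.max/0]_(k <- r) (if (v k).1 \in L then Num.max 0 (v k).2 else 0).
Proof.
elim: r => [|k r IH]; rewrite /max_on ?big_nil//= !big_cons.
have H := max_on_ge0 [seq v k | k <- r] L.
rewrite /max_on in IH H; case: ifP => _; rewrite -IH; last by rewrite max_r.
by rewrite maxAC (@max_r _ _ 0)// maxC.
Qed.

(** [max_on s L] only sees the trace of [L] on the points of [s], so [tau_marginal] lets the ground
    set be enlarged freely. *)
Lemma exponentE theta s M : {in s, forall k, k.1 \in M} ->
  exponent theta s = \sum_(L <- fpowerset M) tau theta M L * max_on s L.
Proof.
move=> sM; rewrite /exponent; set N := [fset t in _]%fset.
have NM : (N `<=` M)%fset.
  by apply/fsubsetP => t; rewrite inE => /mapP[k /sM + ->].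
rewrite -(tau_marginal theta N M) (fsetUidPr _ _ NM).
apply: eq_bigr => L _; congr (_ * _); rewrite /max_on big_seq_cond [RHS]big_seq_cond.
apply: eq_bigl => k; rewrite !inE; case: (boolP (k \in s)) => //= ks.
by rewrite map_f// andbT.
Qed.

Lemma eq_exponent theta s s' : (forall L, max_on s L = max_on s' L) ->
  exponent theta s = exponent theta s'.
Proof.
move=> e; pose M := [fset t in [seq k.1 | k <- s ++ s']]%fset.
rewrite (@exponentE theta s M); last first.
  by move=> k ks; rewrite inE map_f// mem_cat ks.
rewrite (@exponentE theta s' M); last first.
  by move=> k ks; rewrite inE map_f// mem_cat ks orbT.
by under eq_bigr do rewrite e.
Qed.

Lemma exponent_le_max theta s s' : negative_definite theta ->
  (forall L, max_on s L <= max_on s' L) -> exponent theta s <= exponent theta s'.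
Proof.
move=> ndt le_s; pose M := [fset t in [seq k.1 | k <- s ++ s']]%fset.
rewrite (@exponentE theta s M); last first.
  by move=> k ks; rewrite inE map_f// mem_cat ks.
rewrite (@exponentE theta s' M); last first.
  by move=> k ks; rewrite inE map_f// mem_cat ks orbT.
(* The empty set may carry a negative weight, but [max_on] vanishes there. *)
apply: ler_sum => L _; have [->|L0] := eqVneq L fset0; first by rewrite !max_on0.
by rewrite ler_wpM2l// tau_ge0.
Qed.

Lemma exponent_ge0 theta s : negative_definite theta -> 0 <= exponent theta s.
Proof.
move=> ndt; apply: sumr_ge0 => L _.
have [->|L0] := eqVneq L fset0; first by rewrite max_on0 mulr0.
by rewrite mulr_ge0 ?tau_ge0 ?max_on_ge0.
Qed.

Lemma exponent_mem theta s s' : s =i s' -> exponent theta s = exponent theta s'.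
Proof.
move=> ss'; apply: eq_exponent => L; apply/eqP.
by rewrite eq_le; apply/andP; split; apply: sub_bigmax_seq => k; rewrite ss'.
Qed.

Lemma le_exponent theta (X : eqType) (r : seq X) (v : X -> T) (f g : X -> R) :
  negative_definite theta -> {in r, forall k, f k <= g k} ->
  exponent theta [seq (v k, f k) | k <- r] <=
  exponent theta [seq (v k, g k) | k <- r].
Proof.
move=> ndt fg; apply: exponent_le_max => // L.
rewrite !max_on_map/= !big_seq; apply: bigmax_le; first exact: bigmax_ge_id.
move=> k kr; apply: bigmax_sup_seq (kr) (kr) _.
by case: ifP => // _; rewrite ge_max le_max lexx/= le_max fg// orbT.
Qed.

Lemma exponentZ theta (X : eqType) (r : seq X) (v : X -> T) (f : X -> R) (c : R) :
  0 <= c ->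
  exponent theta [seq (v k, c * f k) | k <- r] =
  c * exponent theta [seq (v k, f k) | k <- r].
Proof.
move=> c0; pose M := [fset t in [seq v k | k <- r]]%fset.
rewrite (@exponentE _ _ M); last first.
  by move=> _ /mapP[k kr ->]; rewrite inE/=; apply/mapP; exists k.
rewrite (@exponentE _ _ M); last first.
  by move=> _ /mapP[k kr ->]; rewrite inE/=; apply/mapP; exists k.
rewrite mulr_sumr; apply: eq_bigr => L _; rewrite mulrCA; congr (_ * _).
rewrite !max_on_map/=; elim: r {M} => [|k r IH]; first by rewrite !big_nil mulr0.
rewrite !big_cons IH maxr_pMr//; congr (Num.max _ _).
by case: ifP => // _; rewrite ?maxr_pMr ?mulr0.
Qed.

(** On each nonempty [L] the maximum is [y], so the weights add up by [sum_tau]. This ties the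
    exponent to the extremal coefficients. *)
Lemma exponent_cst theta (r : seq T) (y : R) : theta fset0 = 0 -> 0 <= y ->
  exponent theta [seq (t, y) | t <- r] = y * theta [fset t in r]%fset.
Proof.
move=> theta0 y0; rewrite (@exponentE _ _ [fset t in r]%fset); last first.
  by move=> _ /mapP[k kr ->]; rewrite inE.
rewrite -sum_tau// mulr_sumr [RHS]big_mkcond/=; apply: eq_big_seq => L.
rewrite fpowersetE => /fsubsetP LM.
have [->|/fset0Pn[t tL]] := eqVneq L fset0; first by rewrite max_on0 mulr0.
rewrite mulrC; congr (_ * _); rewrite max_on_map/=; apply/eqP; rewrite eq_le.
apply/andP; split.
  by apply: bigmax_le => // k _; case: ifP => // _; rewrite max_r.
have := LM t tL; rewrite inE => tr.
by apply: bigmax_sup_seq tr _ _ => //; rewrite tL max_r.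
Qed.

Lemma exponent1 theta t (y : R) : theta fset0 = 0 -> theta [fset t]%fset = 1 ->
  0 <= y -> exponent theta [:: (t, y)] = y.
Proof.
move=> theta0 theta1 y0; rewrite -[RHS]mulr1 -[in RHS]theta1.
rewrite -[_ :: _]/[seq (t, y) | t <- [:: t]] exponent_cst//.
by congr (_ * theta _); apply/fsetP => x; rewrite !inE orbF.
Qed.

(** For fixed [L] the maximum is alternating in [K], and its weight is nonnegative. The ground set
    is taken from [J], so one decomposition serves all [K]. *)
Lemma exponent_alternating theta (I : choiceType) (v : I -> T * R) (J : {fset I}) :
  negative_definite theta ->
  alternating J (fun K => exponent theta [seq v k | k <- K]).
Proof.
move=> ndt; pose M := [fset t in [seq (v k).1 | k <- J]]%fset.
apply: (@eq_alternating _ _ _ (fun K => \sum_(L <- fpowerset M)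
    tau theta M L * max_on [seq v k | k <- K] L)).
  move=> K /fsubsetP KJ; rewrite (@exponentE _ _ M)// => _ /mapP[k kK ->].
  by rewrite inE (map_f (fun k => (v k).1))// KJ.
apply: alternating_sum => L _.
have [->|L0] := eqVneq L fset0.
  by apply: eq_alternating (alternating0 J) => K _; rewrite max_on0 mulr0.
apply: alternatingZ; first exact: tau_ge0.
by apply: eq_alternating (alternating_max J _) => K _; rewrite max_on_map.
Qed.

End exponent.

(** * Construction of the process *)

Section construction.
Context {R : realType} {T : choiceType}.

(** Lists allow several levels at one point; the largest reciprocal, that is the smallest level,
    decides. *)
Definition has_exponent d (Om : measurableType d) (P : probability Om R)
    (X : T -> {RV P >-> R}) (theta : {fset T} -> R) : Prop :=
  forall s : seq (T * R), {in s, forall k, 0 < k.2} ->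
    P [set w | {in s, forall k, X k.1 w <= k.2}] =
    (expR (- exponent theta [seq (k.1, k.2^-1) | k <- s]))%:E.

Lemma measurable_in_seq d (Om : measurableType d) (K : eqType) (s : seq K)
    (A : K -> set Om) :
  {in s, forall k, measurable (A k)} ->
  measurable [set w | {in s, forall k, A k w}].
Proof.
elim: s => [|k s IH] sA.
  by rewrite [X in measurable X](_ : _ = setT)//; apply/seteqP; split.
rewrite [X in measurable X](_ : _ = A k `&` [set w | {in s, forall k, A k w}]).
  apply: measurableI; first by apply: sA; rewrite mem_head.
  by apply: IH => j js; apply: sA; rewrite inE js orbT.
apply/seteqP; split => [w sAw|w [Akw sAw] j].
  by split => [|j js]; apply: sAw; rewrite inE ?eqxx// js orbT.
by rewrite inE => /predU1P[->//|/sAw].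
Qed.

(** For passing to the limit from rational levels, which approximate real ones up to a factor close
    to 1. *)
Lemma expR_squeeze (a p : R) : 0 <= a ->
  (forall e, 0 < e < 1 -> expR (- ((1 + e) * a)) <= p <= expR (- ((1 - e) * a))) ->
  p = expR (- a).
Proof.
move=> a0 sq.
have expR_le1 (x : R) : 0 <= x -> expR (- x) <= 1.
  by move=> x0; rewrite -expR0 ler_expR oppr_le0.
have small (e : R) : 0 < e -> exists2 f, 0 < f < 1 & f * a <= e.
  move=> e0; have a1 : 0 < a + 1 by lra.
  (* [2^-1] keeps the witness below 1, and [a + 1] avoids dividing by zero when [a] is 0. *)
  exists (Num.min 2^-1 (e / (a + 1))).
    by rewrite lt_min gt_min divr_gt0//; lra.
  apply: (@le_trans _ _ (e / (a + 1) * a)).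
    by rewrite ler_wpM2r// ge_min lexx orbT.
  by rewrite mulrAC ler_pdivrMr// ler_wpM2l ?(ltW e0)//; lra.
apply/eqP; rewrite eq_le; apply/andP; split; apply/ler_addgt0Pr => e e0;
  have [f f01 fa] := small e e0; have /andP[pe1 pe2] := sq _ f01;
  have fa0 : 0 <= f * a by apply: mulr_ge0 => //; lra.
- have u1 : expR (- ((1 - f) * a)) <= 1.
    by apply: expR_le1; apply: mulr_ge0 => //; lra.
  have : expR (- a) = expR (- ((1 - f) * a)) * expR (- (f * a)).
    by rewrite -expRD; congr expR; ring.
  have := expR_ge1Dx (- (f * a)); have := expR_ge0 (- ((1 - f) * a)).
  by move: pe2 u1; set u := expR (- ((1 - f) * a)); set v := expR (- (f * a)); nra.
- have u1 := expR_le1 _ a0.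
  have : expR (- ((1 + f) * a)) = expR (- a) * expR (- (f * a)).
    by rewrite -expRD; congr expR; ring.
  have := expR_ge1Dx (- (f * a)); have := expR_ge0 (- a).
  by move: pe1 u1; set u := expR (- a); set v := expR (- (f * a)); nra.
Qed.

(** * Random variables read off the bits *)

Section from_bits.
Context d (Om : measurableType d) (P : probability Om R).
Variable bit : T * rat -> set Om.
Hypothesis mbit : forall i, measurable (bit i).

(* [bit (t, q)] plays the event [X_t <= q].  When no positive bit of [t] is set,
   [inf] returns the junk value 0; this null event is part of [bad_bits]. *)
Definition bit_inf (t : T) (w : Om) : R :=
  inf [set r | exists q : rat, [/\ 0 < q, bit (t, q) w & r = ratr q]].

Let lb t w : has_lbound
  [set r : R | exists q : rat, [/\ 0 < q, bit (t, q) w & r = ratr q]].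
Proof. by exists 0 => _ [q [q0 _ ->]]; rewrite ler0q ltW. Qed.

Lemma bit_inf_le t q w : 0 < q -> bit (t, q) w -> bit_inf t w <= ratr q.
Proof. by move=> q0 bq; apply: ge_inf => //; exists q. Qed.

Lemma bit_inf_lt t x w : (exists2 q, 0 < q & bit (t, q) w) ->
  bit_inf t w < x -> exists q, [/\ 0 < q, bit (t, q) w & ratr q < x].
Proof.
move=> [q q0 bq] Xx; have E0 : [set r : R | exists q : rat,
    [/\ 0 < q, bit (t, q) w & r = ratr q]] !=set0 by exists (ratr q), q.
by have [_ [r [r0 br ->]] rx] := inf_lt E0 Xx; exists r.
Qed.

Lemma bit_inf_none t w : ~ (exists2 q, 0 < q & bit (t, q) w) -> bit_inf t w = 0.
Proof.
move=> nb; rewrite /bit_inf (_ : mkset _ = set0) ?inf0//.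
by apply/seteqP; split=> // r [q [q0 bq _]]; case: nb; exists q.
Qed.

Lemma bit_inf_ge0 t w : 0 <= bit_inf t w.
Proof.
have [[q q0 bq]|/bit_inf_none ->//] := pselect (exists2 q, 0 < q & bit (t, q) w).
apply: lb_le_inf; first by exists (ratr q), q.
by move=> _ [r [r0 _ ->]]; rewrite ler0q ltW.
Qed.

(** For positive [x], the infimum is below [x] when some positive bit below [x] is set, or when no
    positive bit is set and the infimum is 0. Both are countable conditions on bits. *)
Lemma measurable_bit_inf t : measurable_fun setT (bit_inf t).
Proof.
apply: (measurability _ (measurable_realfun.RGenInftyO.measurableE R)) => //.
move=> /= _ [_ [x ->] <-]; rewrite setTI.
have [x0|x0] := leP x 0.
  rewrite [X in measurable X](_ : _ = set0)//; apply/seteqP; split=> // w /=.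
  by rewrite in_itv/= ltNge (le_trans x0)// bit_inf_ge0.
pose B q := if 0 < q then bit (t, q) else set0.
have mB q : measurable (B q) by rewrite /B; case: ifP.
rewrite [X in measurable X](_ : _ =
  (\bigcup_q (if ratr q < x then B q else set0)) `|` ~` (\bigcup_q B q)).
  apply: measurableU; first by apply: bigcupT_measurable_rat => q; case: ifP.
  by apply: measurableC; exact: bigcupT_measurable_rat.
have BE w q : B q w -> 0 < q /\ bit (t, q) w by rewrite /B; case: ifP.
have EB w q : 0 < q -> bit (t, q) w -> B q w by rewrite /B => ->.
apply/seteqP; split=> w /=; rewrite in_itv/=.
  move=> Xx; have [bw|nb] := pselect (exists2 q, 0 < q & bit (t, q) w).
    have [q [q0 bq qx]] := bit_inf_lt bw Xx.
    by left; exists q => //; rewrite qx; exact: EB.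
  by right=> -[q _ /BE[q0 bq]]; apply: nb; exists q.
move=> [[q _]|nB].
  by case: ifP => // qx /BE[q0 bq]; apply: le_lt_trans qx; exact: bit_inf_le.
rewrite bit_inf_none// => -[q q0 bq]; apply: nB; exists q => //; exact: EB.
Qed.

Definition bit_rv t : {RV P >-> R} :=
  HB.pack (bit_inf t) (isMeasurableFun.Build _ _ _ _ (bit_inf t) (measurable_bit_inf t)).

(** The two ways in which the bits of [t] fail to describe a threshold. *)
Definition bad_bits t : set Om :=
  [set w | exists q q', [/\ 0 < q', q' < q, bit (t, q') w & ~ bit (t, q) w]] `|`
  [set w | forall q, 0 < q -> ~ bit (t, q) w].

Variable theta : {fset T} -> R.
Hypothesis ndt : negative_definite theta.
Hypothesis theta0 : theta fset0 = 0.
Hypothesis theta1 : forall t, theta [fset t]%fset = 1.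
Hypothesis bitP : forall K : {fset T * rat},
  P [set w | forall i, i \in K -> bit i w] =
  (expR (- exponent theta [seq (k.1, (ratr k.2)^-1) | k <- K]))%:E.

Lemma prob_bits (s : seq (T * rat)) : P [set w | {in s, forall i, bit i w}] =
  (expR (- exponent theta [seq (k.1, (ratr k.2)^-1) | k <- s]))%:E.
Proof.
transitivity (P [set w | forall i, i \in [fset x in s]%fset -> bit i w]).
  congr (P _); apply/seteqP; split=> w sw i; first by rewrite inE => /sw.
  by move=> si; apply: sw; rewrite inE.
rewrite bitP; congr (expR (- _))%:E; apply: exponent_mem => k.
by apply/mapP/mapP => -[i]; rewrite ?inE => si ->; exists i; rewrite ?inE.
Qed.

(** For [q' < q], adding level [q] to [q'] leaves the maximum of the reciprocals unchanged, so each
    of the countably many violations of monotonicity is null. Absence of positive bits has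
    probability at most [1 - expR (- q^-1)], hence at most [q^-1], for every positive [q]. *)
Lemma bad_bits_negligible t : P.-negligible (bad_bits t).
Proof.
apply: negligibleU.
  pose A (p : rat * rat) : set Om := if (0 < p.1) && (p.1 < p.2) then
    bit (t, p.1) `\` bit (t, p.2) else set0.
  have AP q' q w : 0 < q' -> q' < q -> bit (t, q') w -> ~ bit (t, q) w ->
      A (q', q) w.
    by move=> q'0 q'q; rewrite /A /fst /snd q'0 q'q.
  have AE : [set w | exists q q', [/\ 0 < q', q' < q, bit (t, q') w & ~ bit (t, q) w]]
      `<=` \bigcup_n oapp A set0 (choice.unpickle n).
    move=> w [q [q' [q'0 q'q bq' nbq]]].
    exists (choice.pickle (q', q)); first exact: I.
    by rewrite choice.pickleK; apply: AP.
  apply: (negligibleS AE); apply: negligible_bigcup => n.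
  case: (choice.unpickle n) => [[q' q]|] /=; last exact: negligible_set0.
  rewrite /A/=; case: ifPn => [/andP[q'0 q'q]|_]; last exact: negligible_set0.
  apply/negligibleP; first exact: measurableD.
  rewrite measureD//; last by rewrite ltey_eq fin_num_measure.
  have b1 : [set w | {in [:: (t, q')], forall i, bit i w}] = bit (t, q').
    apply/seteqP; split=> w; first by apply; rewrite mem_head.
    by move=> bw i; rewrite inE => /eqP ->.
  have b2 : [set w | {in [:: (t, q'); (t, q)], forall i, bit i w}] =
      bit (t, q') `&` bit (t, q).
    apply/seteqP; split=> w; first by move=> sw; split; apply: sw; rewrite !inE eqxx ?orbT.
    by move=> [bw bw'] i; rewrite !inE => /orP[] /eqP ->.
  transitivity (P (bit (t, q')) - P (bit (t, q') `&` bit (t, q)))%E; first by [].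
  rewrite -b2 -b1 !prob_bits (@eq_exponent _ _ _ _
    [seq (k.1, (ratr k.2)^-1) | k <- [:: (t, q')]]); first by rewrite subee.
  have ler : (ratr q)^-1 <= (ratr q')^-1 :> R.
    by rewrite lef_pV2 ?posrE ?ltr0q// ?ler_rat ?ltW// (lt_trans q'0).
  move=> L; rewrite /max_on !big_cons !big_nil /=; case: (t \in L) => //.
  by rewrite maxA (max_l ler).
have SE : [set w | forall q, 0 < q -> ~ bit (t, q) w] =
    ~` \bigcup_q (if 0 < q then bit (t, q) else set0).
  apply/seteqP; split=> w.
    by move=> nb [q _]; case: ifP => // q0; exact: nb.
  by move=> nB q q0 bq; apply: nB; exists q => //; rewrite q0.
have mS : measurable [set w | forall q, 0 < q -> ~ bit (t, q) w].
  rewrite SE; apply: measurableC; apply: bigcupT_measurable_rat => q.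
  by case: ifP.
apply/negligibleP => //; apply/eqP; rewrite -measure_le0.
suff : (P [set w | forall q, (0 < q)%R -> ~ bit (t, q) w] <= 0)%E by [].
have PS : P [set w | forall q, 0 < q -> ~ bit (t, q) w] \is a fin_num.
  by rewrite fin_num_measure.
rewrite -(fineK PS) lee_fin; apply/ler_addgt0Pr => e e0; rewrite add0r -lee_fin fineK//.
have ei0 : 0 < e^-1 by rewrite invr_gt0.
have /rat_in_itvoo[q] : e^-1 < e^-1 + 1 by lra.
rewrite in_itv/= => /andP[eq _].
have q0 : 0 < q by rewrite -(ltr0q R) (lt_trans ei0).
apply: (@le_trans _ _ (P (~` bit (t, q)))).
  apply: le_measure; rewrite ?inE//; first exact: measurableC.
  by move=> w; exact.
rewrite probability_setC//.
have -> : bit (t, q) = [set w | {in [:: (t, q)], forall i, bit i w}].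
  apply/seteqP; split=> w; last by apply; rewrite mem_head.
  by move=> bw i; rewrite inE => /eqP ->.
rewrite prob_bits /= exponent1// ?invr_ge0 ?ler0q ?(ltW q0)// -EFinB lee_fin.
have := expR_ge1Dx (- (ratr q)^-1 : R).
have : (ratr q)^-1 <= e :> R.
  by rewrite -[e]invrK lef_pV2 ?posrE ?ltr0q ?ltW.
by lra.
Qed.

Lemma bit_inf_le_bit t x q w : ~ bad_bits t w -> 0 < q -> x < ratr q ->
  bit_inf t w <= x -> bit (t, q) w.
Proof.
move=> nbad q0 xq Xx.
have bw : exists2 q, 0 < q & bit (t, q) w.
  apply: contrapT => nb; apply: nbad; right=> r r0 br; apply: nb.
  by exists r.
have [r [r0 br rq]] := bit_inf_lt bw (le_lt_trans Xx xq).
apply: contrapT => nbq; apply: nbad; left; exists q, r; split=> //.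
by rewrite ltr_rat in rq.
Qed.

(** The event is squeezed between bit events at rational levels just below and, up to a null event,
    just above the given ones. Homogeneity of the exponent turns the change of levels into the
    factors [1 + e] and [1 - e]. *)
Lemma bit_rv_exponent : has_exponent bit_rv theta.
Proof.
move=> s s0; set A := [set w | _]; set a := exponent _ _.
have mA : measurable A.
  apply: (@measurable_in_seq _ _ _ s (fun k => [set w | bit_inf k.1 w <= k.2])).
  move=> k _.
  rewrite -[X in measurable X]setTI -preimage_itvNyc.
  exact: measurable_bit_inf.
have PA : P A \is a fin_num by rewrite fin_num_measure.
rewrite -(fineK PA); congr _%:E; apply: expR_squeeze.
- exact: exponent_ge0.
move=> e /andP[e0 e1]; apply/andP; split; rewrite -lee_fin fineK//.
  have /choice[q qP] : forall x : R, exists q : rat, 0 < x ->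
      0 < q /\ (1 + e)^-1 * x < ratr q < x.
    move=> x; have [x0|_] := ltP 0 x; last by exists 0.
    have ex0 : 0 < (1 + e)^-1 * x by rewrite mulr_gt0// invr_gt0; lra.
    have /rat_in_itvoo[q] : (1 + e)^-1 * x < x.
      by rewrite gtr_pMl// invf_lt1; lra.
    rewrite in_itv/= => qx; exists q => _; split=> //.
    by rewrite -(ltr0q R) (lt_trans ex0)//; case/andP: qx.
  apply: (@le_trans _ _ (P [set w | {in [seq (k.1, q k.2) | k <- s], forall i, bit i w}])).
    rewrite prob_bits lee_fin ler_expR lerN2 -exponentZ; last by lra.
    rewrite -map_comp; apply: le_exponent => // k ks /=.
    have [q0 /andP[qk _]] := qP _ (s0 k ks); have k0 := s0 k ks.
    rewrite -[1 + e]invrK -invfM lef_pV2 ?posrE ?ltr0q ?ltW//.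
    by rewrite mulr_gt0// invr_gt0; lra.
  apply: le_measure; rewrite ?inE//; first exact: measurable_in_seq.
  move=> w bw k ks /=; have [q0 /andP[_ qk]] := qP _ (s0 k ks).
  apply: le_trans (ltW qk); apply: bit_inf_le => //.
  by apply: bw; apply/mapP; exists k.
have /choice[q qP] : forall x : R, exists q : rat, 0 < x ->
    0 < q /\ x < ratr q < (1 - e)^-1 * x.
  move=> x; have [x0|_] := ltP 0 x; last by exists 0.
  have /rat_in_itvoo[q] : x < (1 - e)^-1 * x.
    by rewrite ltr_pMl// invf_gt1; lra.
  rewrite in_itv/= => qx; exists q => _; split=> //.
  by rewrite -(ltr0q R) (lt_trans x0)//; case/andP: qx.
pose B := [set w | {in [seq (k.1, q k.2) | k <- s], forall i, bit i w}].
have mB : measurable B by exact: measurable_in_seq.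
have [N [mN N0 badN]] : P.-negligible [set w | exists2 k, k \in s & bad_bits k.1 w].
  elim: (s) => [|k r IH].
    apply: negligibleS (negligible_set0 P) => w [k]; by rewrite inE.
  apply: negligibleS (negligibleU (bad_bits_negligible k.1) IH) => w [j].
  by rewrite inE => /predU1P[->|jr] bad; [left|right; exists j].
apply: (@le_trans _ _ (P (B `|` N))).
  apply: le_measure; rewrite ?inE//; first exact: measurableU.
  move=> w Aw; have [bad|nbad] := pselect (exists2 k, k \in s & bad_bits k.1 w).
    by right; exact: badN.
  left=> _ /mapP[k ks ->]; have [q0 /andP[kq _]] := qP _ (s0 k ks).
  apply: (bit_inf_le_bit _ q0 kq); last exact: Aw.
  by move=> bad; apply: nbad; exists k.
have PBN : (P (B `|` N) <= P B + P N)%E by exact: measureU2.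
have PN : P N = 0%E by [].
apply: (le_trans PBN); rewrite PN adde0 prob_bits lee_fin ler_expR lerN2.
rewrite -exponentZ; last by lra.
rewrite -map_comp; apply: le_exponent => // k ks /=.
have [q0 /andP[_ qk]] := qP _ (s0 k ks); have k0 := s0 k ks.
rewrite -[1 - e]invrK -invfM lef_pV2 ?posrE ?ltr0q ?ltW//.
by rewrite mulr_gt0// invr_gt0; lra.
Qed.

End from_bits.

Lemma exponent_process (theta : {fset T} -> R) : negative_definite theta ->
  theta fset0 = 0 -> (forall t, theta [fset t]%fset = 1) ->
  exists (d : measure_display) (Om : measurableType d) (P : probability Om R)
    (X : T -> {RV P >-> R}), has_exponent X theta.
Proof.
move=> ndt theta0 theta1.
have [] := @mixture_extension R _ (fun K : {fset T * rat} =>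
  expR (- exponent theta [seq (k.1, (ratr k.2)^-1) | k <- K])).
(* At the empty set of bits the exponent is that of an empty list, hence 0. *)
- rewrite (_ : [seq _ | _ <- _] = [seq (t, 0) | t <- [::]]) ?exponent_cst//.
    by rewrite mul0r oppr0 expR0.
- move=> J; apply: mixture_exp.
  exact: (@exponent_alternating _ _ _ _ (fun k : T * rat => (k.1, (ratr k.2)^-1))).
move=> d [Om [P [bit [mbit bitP]]]].
exists d, Om, P, (bit_rv P mbit); exact: bit_rv_exponent.
Qed.

End construction.

(** * Finite-dimensional laws and max-stability *)

Section finite_dimensional_laws.
Context {R : realType} {T : choiceType}.

Lemma measurable_forall_ord d (Om : measurableType d) k (A : 'I_k -> set Om) :
  (forall i, measurable (A i)) -> measurable [set w | forall i, A i w].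
Proof.
move=> mA; rewrite [X in measurable X](_ : _ =
  [set w | {in enum 'I_k, forall i, A i w}]); first exact: measurable_in_seq.
by apply/seteqP; split=> w Aw i; [move=> _|]; apply: Aw; rewrite mem_enum.
Qed.

Lemma bigmaxe_le (s : seq T) (f : T -> R) x :
  (\big[maxe/-oo]_(t <- s) (f t)%:E <= x%:E)%E <-> {in s, forall t, f t <= x}.
Proof.
elim: s => [|t s IH]; first by rewrite big_nil leNye.
rewrite big_cons ge_max lee_fin; split=> [/andP[ft /IH fs] k|fs].
  by rewrite inE => /predU1P[->|/fs].
rewrite fs ?mem_head//=; apply/IH => k ks; apply: fs.
by rewrite inE ks orbT.
Qed.

Definition lower_orthant k (x : 'I_k -> R) : set (k.-tuple R) :=
  [set v | forall i, tnth v i <= x i].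

Lemma measurable_lower_orthant k (x : 'I_k -> R) : measurable (lower_orthant x).
Proof.
apply: measurable_forall_ord => i.
have := @measurable_tnth _ R k i measurableT _ (measurable_itv `]-oo, (x i)]).
by rewrite setTI; congr measurable; apply/seteqP; split=> v /=; rewrite in_itv.
Qed.

(** A half-space bounding one coordinate is the union over [n] of the orthants that bound the other
    coordinates by [n]. *)
Lemma measurable_tuple_lower_orthants k :
  @measurable _ (k.-tuple R) = <<s range (@lower_orthant k) >>.
Proof.
apply/seteqP; split; last first.
  apply: smallest_sub; first exact: sigma_algebra_measurable.
  by move=> _ [x _ <-]; exact: measurable_lower_orthant.
apply: smallest_sub; first exact: smallest_sigma_algebra.
rewrite -bigcup_seq => _ [i _ [B mB <-]].
pose G := range (@lower_orthant k).
suff : measurable_fun setT ((fun v => tnth v i) : g_sigma_algebraType G -> R).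
  by move/(_ measurableT _ mB).
apply: (measurability _ (measurable_realfun.RGenOInfty.measurableE R)) => //.
move=> _ [_ [x ->] <-]; rewrite setTI -setCitvl preimage_setC.
apply: measurableC.
rewrite [X in measurable X](_ : _ = \bigcup_n
    lower_orthant (fun j => if j == i then x else n%:R)).
  apply: bigcupT_measurable => n; apply: sub_sigma_algebra.
  by exists (fun j => if j == i then x else n%:R).
apply/seteqP; split => v /=; rewrite in_itv/=; last first.
  by move=> [n _ /(_ i)]; rewrite eqxx.
move=> vi; exists (Num.bound (\sum_j `|tnth v j|)) => // j.
case: eqP => [->//|_]; apply/ltW/(le_lt_trans _ (archi_boundP _)).
  by rewrite (bigD1 j)//= (le_trans (ler_norm _))// lerDl sumr_ge0.
by rewrite sumr_ge0.
Qed.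

(** Lower orthants generate the sigma-algebra, are stable under intersection and exhaust the space,
    so uniqueness of measures applies. *)
Lemma same_law_lower_orthant d d' (Om : measurableType d) (Om' : measurableType d')
    (P : probability Om R) (X : T -> Om -> R)
    (P' : probability Om' R) (Y : T -> Om' -> R) :
  (forall t, measurable_fun setT (X t)) -> (forall t, measurable_fun setT (Y t)) ->
  (forall k (t : k.-tuple T) (x : 'I_k -> R),
    P [set w | forall i, X (tnth t i) w <= x i] =
    P' [set w | forall i, Y (tnth t i) w <= x i]) ->
  same_law P X P' Y.
Proof.
move=> mX mY XY k t B mB.
pose fX w := [tuple X (tnth t i) w | i < k].
pose fY w := [tuple Y (tnth t i) w | i < k].
have mfX : measurable_fun setT fX.
  apply/measurable_fun_tnthP => i.
  rewrite (_ : _ \o _ = X (tnth t i))//; apply/funext => w.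
  by rewrite /fX/= tnth_mktuple.
have mfY : measurable_fun setT fY.
  apply/measurable_fun_tnthP => i.
  rewrite (_ : _ \o _ = Y (tnth t i))//; apply/funext => w.
  by rewrite /fY/= tnth_mktuple.
pose FX : {RV P >-> k.-tuple R} := HB.pack fX (isMeasurableFun.Build _ _ _ _ fX mfX).
pose FY : {RV P' >-> k.-tuple R} := HB.pack fY (isMeasurableFun.Build _ _ _ _ fY mfY).
apply: (measure_unique (range (@lower_orthant k))
  (fun n => lower_orthant (fun=> n%:R)) _ _ _ _
  (distribution P FX) (distribution P' FY)) => //.
- exact: measurable_tuple_lower_orthants.
- move=> _ _ [x _ <-] [y _ <-]; exists (fun i => Num.min (x i) (y i)) => //.
  apply/seteqP; split=> v /=.
    by move=> vxy; split=> i; have := vxy i; rewrite le_min => /andP[].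
  by move=> [vx vy] i; rewrite le_min vx vy.
- apply/seteqP; split=> // v _; exists (Num.bound (\sum_j `|tnth v j|)) => // j.
  apply/ltW/(le_lt_trans _ (archi_boundP _)); last by rewrite sumr_ge0.
  by rewrite (bigD1 j)//= (le_trans (ler_norm _))// lerDl sumr_ge0.
- move=> _ [x _ <-]; have := XY k t x.
  rewrite /distribution /pushforward /= => XYx.
  transitivity (P [set w | forall i, X (tnth t i) w <= x i]).
    by congr (P _); apply/seteqP; split=> w /= xw i; have := xw i; rewrite tnth_mktuple.
  rewrite XYx.
  by congr (P' _); apply/seteqP; split=> w /= xw i; have := xw i; rewrite tnth_mktuple.
- by move=> n; rewrite ltey_eq fin_num_measure//; exact: measurable_lower_orthant.
Qed.

(** * Consequences of the exponent formula: max-stability and extremal coefficients *)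

Section from_exponent.
Context d (Om : measurableType d) (P : probability Om R).
Context (X : T -> {RV P >-> R}) (theta : {fset T} -> R).
Hypothesis XP : has_exponent X theta.
Hypothesis theta0 : theta fset0 = 0.
Hypothesis theta1 : forall t, theta [fset t]%fset = 1.

Lemma prob_le1 t x : 0 < x -> P [set w | X t w <= x] = (expR (- x^-1))%:E.
Proof.
move=> x0; have := XP (s := [:: (t, x)]).
rewrite /= exponent1// ?invr_ge0 ?ltW// => <-; last first.
  by move=> k; rewrite inE => /eqP ->.
congr (P _); apply/seteqP; split=> w /=; last by move/(_ (t, x)); apply; rewrite mem_head.
by move=> Xw k; rewrite inE => /eqP ->.
Qed.

Lemma measurable_Xle t x : measurable [set w | X t w <= x].
Proof.
rewrite -[X in measurable X]setTI -preimage_itvNyc.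
exact: measurable_funPT.
Qed.

(** For each positive [e] the event lies in [X t w <= e], of probability [expR (- e^-1)], which is
    at most [e]. *)
Lemma prob_le_nonpos t x : x <= 0 -> P [set w | X t w <= x] = 0%E.
Proof.
move=> x0; apply/eqP; rewrite -measure_le0.
suff : (P [set w | (X t w <= x)%R] <= 0)%E by [].
have PS : P [set w | X t w <= x] \is a fin_num.
  by rewrite fin_num_measure//; exact: measurable_Xle.
rewrite -(fineK PS) lee_fin; apply/ler_addgt0Pr => e e0; rewrite add0r -lee_fin fineK//.
apply: (@le_trans _ _ (P [set w | X t w <= e])).
  apply: le_measure; rewrite ?inE; try exact: measurable_Xle.
  by move=> w /= /le_trans; apply; rewrite ltW// (le_lt_trans x0).
rewrite prob_le1// lee_fin expRN -[leRHS]invrK lef_pV2 ?posrE ?invr_gt0 ?expR_gt0//.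
by apply: le_trans (expR_ge1Dx _); lra.
Qed.

Lemma prob_lower_orthant k (t : k.-tuple T) (x : 'I_k -> R) : (forall i, 0 < x i) ->
  P [set w | forall i, X (tnth t i) w <= x i] =
  (expR (- exponent theta [seq (tnth t i, (x i)^-1) | i <- enum 'I_k]))%:E.
Proof.
move=> x0; have := XP (s := [seq (tnth t i, x i) | i <- enum 'I_k]).
rewrite -(map_comp _ _ (enum 'I_k)) => <-; last by move=> _ /mapP[i _ ->]; exact: x0.
congr (P _); apply/seteqP; split=> w /=.
  by move=> Xw _ /mapP[i _ ->]; exact: Xw.
by move=> Xw i; apply: (Xw (tnth t i, x i)); rewrite map_f// mem_enum.
Qed.

(** The maximum is below [x] when every copy is, so independence raises the probability to the power
    [n.+1]. Homogeneity of the exponent gives the same power for the rescaled process. *)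
Lemma has_exponent_simple_max_stable : simple_max_stable X.
Proof.
split=> [t x x0|n d' Om' P' Y YX indep].
  rewrite -(prob_le1 t x0) /cdf /distribution /pushforward.
  by congr (P _); apply/seteqP; split=> w /=; rewrite in_itv.
have mY i t : measurable_fun setT (Y i t) by exact: measurable_funPT.
apply: same_law_lower_orthant.
- move=> t; set Z := fun w => \big[Num.max/_]_(_ < _) _.
  have -> : Z = (fun w => \big[Num.max/Y ord0 t w]_(i <- index_enum 'I_n.+1) Y i t w) by [].
  elim: (index_enum _) => [|i r IH].
    by under eq_fun do rewrite big_nil; exact: mY.
  by under eq_fun do rewrite big_cons; exact: measurable_maxr.
- by move=> t; apply: measurable_funM => //; exact: measurable_funPT.
move=> k t x.
pose E i := [set w | forall j, Y i (tnth t j) w <= x j].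
have PE i : P' (E i) = P [set w | forall j, X (tnth t j) w <= x j].
  have := YX i k t _ (measurable_lower_orthant x).
  rewrite /lower_orthant /= => H; transitivity (P' [set w |
    forall j, tnth [tuple Y i (tnth t j0) w | j0 < k] j <= x j]).
    by congr (P' _); apply/seteqP; split=> w /= xw j; have := xw j; rewrite tnth_mktuple.
  rewrite H.
  by congr (P _); apply/seteqP; split=> w /= xw j; have := xw j; rewrite tnth_mktuple.
have sE i : process_sigma (fun t => Y i t) (E i).
  pose G := [set A | exists t (B : set R), measurable B /\ A = Y i t @^-1` B].
  (* Equipping the space with the sigma-algebra generated by copy [i] turns membership in
     [process_sigma] into measurability. *)
  apply: (@measurable_forall_ord _ (g_sigma_algebraType G)) => j.
  apply: sub_sigma_algebra; exists (tnth t j), `]-oo, (x j)]%classic.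
  by split; [exact: measurable_itv|apply/seteqP; split=> w /=; rewrite in_itv].
have maxE : [set w | forall j, \big[Num.max/Y ord0 (tnth t j) w]_(i < n.+1)
    Y i (tnth t j) w <= x j] = \bigcap_(i in [set` [set: 'I_n.+1]%SET]) E i.
  apply/seteqP; split=> w /=.
    move=> Ew i _ j; apply: le_trans (Ew j).
    by apply: bigmax_sup_seq (mem_index_enum i) _ _.
  move=> Ew j; apply: bigmax_le => [|i _]; first by apply: Ew; rewrite /= inE.
  by apply: Ew; rewrite /= inE.
rewrite maxE indep; last by move=> i _; exact: sE.
have -> : [set w | forall j, n.+1%:R * X (tnth t j) w <= x j] =
    [set w | forall j, X (tnth t j) w <= n.+1%:R^-1 * x j].
  by apply/seteqP; split=> w /= xw j; have := xw j; rewrite ler_pdivlMl.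
have [x0|/existsNP[j /negP]] := pselect (forall j, 0 < x j).
  under eq_bigr do rewrite PE.
  rewrite !prob_lower_orthant//; last by move=> j; rewrite mulr_gt0.
  under [in RHS]eq_map do rewrite invfM invrK.
  rewrite exponentZ//.
  rewrite -(big_morph EFin EFinM erefl) prodr_const cardsT card_ord.
  by rewrite -expRM_natl mulrN mulr_natl.
(* With a nonpositive level both sides vanish. *)
rewrite -leNgt => xj.
have PA0 (y : R) : y <= 0 -> forall A : set Om, measurable A ->
    A `<=` [set w | X (tnth t j) w <= y] -> P A = 0%E.
  move=> y0 A mA Ay; apply/eqP; rewrite -measure_le0 -(prob_le_nonpos (tnth t j) y0).
  by apply: le_measure => //; rewrite inE//; exact: measurable_Xle.
rewrite (PA0 (n.+1%:R^-1 * x j)).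
- rewrite (bigD1 ord0) ?inE//= PE (PA0 (x j)) ?mul0e// => [|w]; last by exact.
  by apply: measurable_forall_ord => i; exact: measurable_Xle.
- by rewrite pmulr_rle0.
- by apply: measurable_forall_ord => i; exact: measurable_Xle.
- by move=> w; exact.
Qed.

Lemma has_exponent_is_ECF : is_ECF X theta.
Proof.
split=> // A x A0 x0.
have -> : [set w | (\big[maxe/-oo]_(t <- A) (X t w)%:E <= x%:E)%E] =
    [set w | {in [seq (t, x) | t <- A], forall k, X k.1 w <= k.2}].
  apply/seteqP; split=> w /= => [/bigmaxe_le Xw _ /mapP[t tA ->]|Xw].
    exact: Xw.
  by apply/bigmaxe_le => t tA; apply: (Xw (t, x)); exact: map_f.
rewrite XP; last by move=> _ /mapP[t _ ->].
rewrite -map_comp (@exponent_cst _ _ theta A x^-1)//; last by rewrite invr_ge0 ltW.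
rewrite lne_EFin ?expR_gt0// expRK -EFinM -EFinN mulrN opprK mulVKf ?gt_eqF//.
by congr (theta _)%:E; apply/fsetP => t; rewrite inE.
Qed.

Lemma has_exponent_fset (M : {fset T}) (x : M -> R) : (forall t, 0 < x t) ->
  (- lne (P [set w | forall t : M, (X (val t) w <= x t)%R]) =
   (\sum_(L <- fpowerset M | L != fset0) tau theta M L *
      \big[Num.max/0]_(t : M | val t \in L) (x t)^-1)%:E)%E.
Proof.
move=> x0; have -> : [set w | forall t : M, X (val t) w <= x t] =
    [set w | {in [seq (val t, x t) | t <- index_enum M], forall k, X k.1 w <= k.2}].
  apply/seteqP; split=> w /=.
    by move=> Xw _ /mapP[t _ ->]; exact: Xw.
  by move=> Xw t; apply: (Xw (val t, x t)); rewrite map_f// mem_index_enum.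
rewrite XP; last by move=> _ /mapP[t _ ->]; exact: x0.
rewrite -map_comp lne_EFin ?expR_gt0// expRK -EFinN opprK; congr _%:E.
rewrite (@exponentE _ _ _ _ M); last by move=> _ /mapP[t _ ->]; exact: valP.
rewrite [RHS]big_mkcond/=; apply: eq_bigr => L _.
have [->|L0] := eqVneq L fset0; first by rewrite max_on0 mulr0.
by rewrite /max_on big_map.
Qed.

End from_exponent.
End finite_dimensional_laws.

(** * Spectral measures *)

Section spectral_measure.
Context {R : realType} {T : choiceType} (M : {fset T}).
Variable N : (M -> R) -> R.
Hypothesis normN : is_norm N.

Let N_ge0 a : 0 <= N a. Proof. by case: normN. Qed.

Let NZ (c : R) a : N (fun t => c * a t) = `|c| * N a. Proof. by case: normN. Qed.

Let ND a b : N (fun t => a t + b t) <= N a + N b. Proof. by case: normN. Qed.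

Lemma norm0_eq0 : N (fun=> 0) = 0.
Proof.
transitivity (N (fun t => 0 * 0)); last by rewrite NZ normr0 mul0r.
by congr N; apply/funext => t; rewrite mul0r.
Qed.

(** Expansion in the coordinate basis and the triangle inequality; this makes [N] continuous for the
    product topology. *)
Lemma norm_le_coord (h : M -> R) :
  N h <= \sum_t `|h t| * N (fun s => (s == t)%:R).
Proof.
have -> : h = (fun s => \sum_t h t * (s == t)%:R).
  apply/funext => s; rewrite (bigD1 s)//= eqxx mulr1 big1 ?addr0// => t /negbTE.
  by rewrite eq_sym => ->; rewrite mulr0.
rewrite [leRHS](_ : _ = \sum_t `|h t| * N (fun s => (s == t)%:R)); last first.
  apply: eq_bigr => t _; congr (`|_| * _).
  rewrite (bigD1 t)//= eqxx mulr1 big1 ?addr0// => s /negbTE.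
  by rewrite eq_sym => ->; rewrite mulr0.
elim: (index_enum _) => [|t r IH].
  rewrite big_nil (_ : (fun _ => _) = fun=> 0) ?norm0_eq0//.
  by apply/funext => s; rewrite big_nil.
rewrite big_cons (_ : (fun _ => _) = (fun s => h t * (s == t)%:R +
    \sum_(j <- r) h j * (s == j)%:R)); last first.
  by apply/funext => s; rewrite big_cons.
by apply: (le_trans (ND _ _)); rewrite NZ lerD2l.
Qed.

Lemma norm_dist (a b : M -> R) : `|N a - N b| <= N (fun t => a t - b t).
Proof.
have sub (u v : M -> R) : N u - N v <= N (fun t => u t - v t).
  rewrite lerBlDr; apply: le_trans (ND _ _).
  by rewrite le_eqVlt; apply/orP; left; apply/eqP; congr N; apply/funext => t; rewrite subrK.
rewrite ler_norml sub andbT lerNl opprB (le_trans (sub _ _))//.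
rewrite -[leRHS]mul1r -normrN1 -NZ le_eqVlt; apply/orP; left; apply/eqP.
by congr N; apply/funext => t; rewrite mulN1r opprB.
Qed.

Lemma norm_continuous : continuous (N : {ptws M -> R} -> R).
Proof.
move=> a.
have Fa : Filter (nbhs a) := nbhs_filter a.
apply/(@cvgrPdist_le _ _ _ _ Fa) => e e0; pose C := \sum_t N (fun s => (s == t)%:R) + 1.
have C0 : 0 < C by rewrite ltr_wpDl// sumr_ge0.
have near_coord (t : M) : \forall b \near a, `|a t - b t| <= e / C.
  have ca := @proj_continuous M (fun=> R) t a.
  have /(_ (e / C)) := (@cvgrPdist_le _ _ _ _ Fa _ _).1 ca.
  by apply; rewrite divr_gt0.
have := @filter_forall _ _ (fun t b => `|a t - b t| <= e / C) _ Fa near_coord.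
apply: filterS => b ab; rewrite (le_trans (norm_dist _ _))//.
apply: (le_trans (norm_le_coord _)).
apply: (@le_trans _ _ (e / C * \sum_t N (fun s => (s == t)%:R))).
  by rewrite mulr_sumr; apply: ler_sum => t _; rewrite ler_wpM2r.
rewrite mulrAC ler_pdivrMr// ler_wpM2l ?(ltW e0)//.
by rewrite lerDl.
Qed.

Lemma open_measurable_RM (A : set (RM (R := R) M)) :
  open (A : set {ptws M -> R}) -> measurable A.
Proof. by move=> oA; exact: sub_sigma_algebra. Qed.

Lemma measurable_continuous_RM (f : {ptws M -> R} -> R) : continuous f ->
  measurable_fun setT (f : RM (R := R) M -> R).
Proof.
move=> cf; apply: (measurability _ (RGenOpens.measurableE R)) => //.
move=> _ [_ [a [b ->] <-]]; rewrite setTI; apply: open_measurable_RM.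
by move/continuousP: cf; apply; exact: interval_open.
Qed.

Lemma measurable_nneg_sphere : measurable (nneg_sphere N).
Proof.
have mN := measurable_continuous_RM norm_continuous.
have -> : nneg_sphere N = [set a | {in index_enum M, forall t, 0 <= a t}] `&`
    N @^-1` [set 1] :> set (RM (R := R) M).
  apply/seteqP; split=> a [a0 Na]; split=> // t.
  by apply: a0; rewrite mem_index_enum.
apply: measurableI; last by rewrite -[X in measurable X]setTI; exact: mN.
have := @measurable_in_seq _ (RM (R := R) M) M (index_enum M)
  (fun t => [set a : RM (R := R) M | 0 <= a t]).
apply.
move=> t _.
have := @measurable_continuous_RM (fun a => a t) (@proj_continuous _ _ t)
  measurableT _ (measurable_itv `[0, +oo[).
by rewrite setTI; congr measurable; apply/seteqP; split=> a /=; rewrite in_itv/= andbT.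
Qed.

Lemma measurable_max_ratio (x : M -> R) :
  measurable_fun setT (fun a : RM (R := R) M => \big[Num.max/0]_(t : M) (a t / x t)).
Proof.
pose S (r : seq M) (a : RM (R := R) M) : R := \big[Num.max/0]_(t <- r) (a t / x t).
suff mS r : measurable_fun setT (S r) by exact: mS.
elim: r => [|t r IH].
  have -> : S [::] = cst 0 by apply/funext => a; rewrite /S big_nil.
  exact: measurable_cst.
pose f (a : RM (R := R) M) : R := a t.
have mf : measurable_fun setT f.
  exact: (@measurable_continuous_RM (fun a => a t) (@proj_continuous _ _ t)).
have -> : S (t :: r) = (fun a => f a * (x t)^-1) \max S r.
  by apply/funext => a; rewrite /S big_cons.
apply: measurable_maxr => //; apply: measurable_funM => //; exact: measurable_cst.
Qed.

Variable theta : {fset T} -> R.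
Hypothesis ndt : negative_definite theta.

Let c L : R := tau theta M L * N (indic_vec L).

(** At the empty set [tau] may be negative, but the indicator vanishes and so does its norm. *)
Let c_ge0 L : 0 <= c L.
Proof.
rewrite /c; have [->|L0] := eqVneq L fset0; last by rewrite mulr_ge0// tau_ge0.
by rewrite (_ : indic_vec _ = fun=> 0) ?norm0_eq0 ?mulr0.
Qed.

Let subs := [seq L <- fpowerset M | L != fset0].

(** [Hstar] rebuilt from sums, scalings and Dirac masses, so that it is a measure by
    construction. *)
Definition spectral_sum : set (RM (R := R) M) -> \bar R :=
  msum (fun k => mscale (NngNum (c_ge0 (nth fset0 subs k)))
    (dirac (unit_indic N (nth fset0 subs k)))) (size subs).

HB.instance Definition _ := Measure.on spectral_sum.

Lemma spectral_sumE B : spectral_sum B = Hstar theta N B.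
Proof.
rewrite /Hstar -big_filter -/subs (big_nth fset0) big_mkord /spectral_sum /msum.
by apply: eq_bigr => i _; rewrite /mscale.
Qed.

Lemma norm_indic_gt0 L : L \in subs -> 0 < N (indic_vec L).
Proof.
rewrite mem_filter fpowersetE => /andP[/fset0Pn[t tL] /fsubsetP LM].
rewrite lt_neqAle N_ge0 andbT eq_sym; apply/eqP => NL0.
have [_ /(_ _ NL0)/(_ [` LM t tL]%fset) + _ _] := normN.
by rewrite /indic_vec/= tL => /eqP; rewrite oner_eq0.
Qed.

Lemma unit_indic_sphere L : L \in subs -> nneg_sphere N (unit_indic N L).
Proof.
move=> Ls; have NL0 := norm_indic_gt0 Ls.
split=> [t|]; first by rewrite divr_ge0// ler0n.
rewrite (_ : unit_indic N L = fun t => (N (indic_vec L))^-1 * indic_vec L t).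
  by rewrite NZ gtr0_norm ?invr_gt0// mulVf// gt_eqF.
by apply/funext => t; rewrite /unit_indic mulrC.
Qed.

Lemma max_ratio_unit_indic L (x : M -> R) : L \in subs ->
  \big[Num.max/0]_(t : M) (unit_indic N L t / x t) =
  (N (indic_vec L))^-1 * \big[Num.max/0]_(t : M | val t \in L) (x t)^-1.
Proof.
move=> Ls; have NL0 := norm_indic_gt0 Ls.
rewrite /unit_indic /indic_vec -/(indic_vec L).
elim: (index_enum _) => [|t r IH]; first by rewrite !big_nil mulr0.
rewrite !big_cons IH.
have H : 0 <= (N (indic_vec L))^-1 * \big[Num.max/0]_(t <- r | val t \in L) (x t)^-1.
  by rewrite mulr_ge0 ?bigmax_ge_id// invr_ge0.
case: ifP => tL; last by rewrite !mul0r max_r.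
by rewrite mul1r maxr_pMr// invr_ge0.
Qed.

Lemma spectral_sum_sphereC : spectral_sum (~` nneg_sphere N) = 0%E.
Proof.
rewrite /spectral_sum /msum big1// => i _.
have Ls : nth fset0 subs i \in subs by exact: mem_nth.
transitivity ((c (nth fset0 subs i))%:E *
  \d_(unit_indic N (nth fset0 subs i)) (~` nneg_sphere N))%E; first by [].
by rewrite diracE memNset ?mule0//; apply; exact: unit_indic_sphere.
Qed.

Lemma spectral_sum_fin : fin_num_fun spectral_sum.
Proof.
by move=> B mB; apply/sum_fin_numP => i _ _; rewrite /mscale/= fin_numM.
Qed.

(** Each Dirac mass evaluates the integrand at a normalised indicator, and the norm in its weight
    cancels the normalisation. *)
Lemma integral_spectral_sum (x : M -> R) : (forall t, 0 < x t) ->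
  (\int[spectral_sum]_(a in nneg_sphere N) (\big[Num.max/0]_(t : M) (a t / x t))%R%:E =
   (\sum_(L <- fpowerset M | L != fset0) tau theta M L *
      \big[Num.max/0]_(t : M | val t \in L) (x t)^-1)%:E)%E.
Proof.
move=> x0; have mD := measurable_nneg_sphere.
have f0 (a : RM (R := R) M) : nneg_sphere N a ->
    (0 <= (\big[Num.max/0]_(t : M) (a t / x t))%R%:E)%E.
  by move=> _; rewrite lee_fin bigmax_ge_id.
have mf : measurable_fun (nneg_sphere N)
    (fun a : RM (R := R) M => (\big[Num.max/0]_(t : M) (a t / x t))%R%:E).
  apply/measurable_EFinP; apply: measurable_funS (measurable_max_ratio x) => //.
rewrite -[in RHS]big_filter -/subs (big_nth fset0) big_mkord.
rewrite ge0_integral_measure_sum// -sumEFin; apply: eq_bigr => i _.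
have Ls : nth fset0 subs i \in subs by exact: mem_nth.
rewrite ge0_integral_mscale// integral_dirac// diracE mem_set ?mul1e; last first.
  exact: unit_indic_sphere.
rewrite max_ratio_unit_indic// -EFinM /= /c mulrA mulfK//.
by rewrite gt_eqF// norm_indic_gt0.
Qed.

Lemma exists_spectral_measure d (Om : measurableType d) (P : probability Om R)
    (X : T -> {RV P >-> R}) : has_exponent X theta ->
  exists H : {finite_measure set (RM (R := R) M) -> \bar R},
    (forall B : set (RM M), measurable B -> H B = Hstar theta N B) /\
    is_spectral_measure X N H.
Proof.
move=> XP.
pose H : {finite_measure set (RM (R := R) M) -> \bar R} := HB.pack spectral_sum
  (Measure_isFinite.Build _ _ _ spectral_sum spectral_sum_fin).
exists H; split; first by move=> B _; exact: spectral_sumE.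
split; first exact: spectral_sum_sphereC.
move=> x x0; rewrite (has_exponent_fset XP)//.
by rewrite -integral_spectral_sum.
Qed.

End spectral_measure.

(** * Extremal coefficient functions are negative definite *)

Section necessity.
Context {R : realType} {T : choiceType}.

(** The form is the integral of the square of the combination of indicators with coefficients
    [a]. *)
Lemma gram_indic_ge0 d (Om : measurableType d) (P : probability Om R) n
    (A : 'I_n -> set Om) (a : 'I_n -> R) : (forall i, measurable (A i)) ->
  0 <= \sum_(j < n) \sum_(k < n) a j * a k * fine (P (A j `&` A k)).
Proof.
move=> mA; pose g j k (w : Om) : \bar R :=
  ((a j * a k)%:E * (\1_(A j `&` A k) w)%:E)%E.
have mAA j k : measurable (A j `&` A k) by exact: measurableI.
have ig j k : P.-integrable setT (g j k).
  by apply: integrableZl => //; exact: integrable_indic.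
have Ig j k : (\int[P]_w g j k w = (a j * a k * fine (P (A j `&` A k)))%:E)%E.
  rewrite /g integralZl//; last exact: integrable_indic.
  by rewrite integral_indic// setIT [in RHS]EFinM fineK// fin_num_measure.
rewrite -lee_fin.
have -> : (\sum_(j < n) \sum_(k < n) a j * a k * fine (P (A j `&` A k)))%:E =
    (\int[P]_w \sum_(j < n) \sum_(k < n) g j k w)%E.
  rewrite integral_sum//; last by move=> j; exact: integrable_sum.
  rewrite -sumEFin; apply: eq_bigr => j _; rewrite integral_sum// -sumEFin.
  by apply: eq_bigr => k _; rewrite Ig.
apply: integral_ge0 => w _.
suff -> : (\sum_(j < n) \sum_(k < n) g j k w =
    ((\sum_(j < n) a j * \1_(A j) w) ^+ 2)%:E)%E by rewrite lee_fin sqr_ge0.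
rewrite expr2 mulr_suml -sumEFin; apply: eq_bigr => j _.
rewrite mulr_sumr -sumEFin; apply: eq_bigr => k _.
by rewrite /g indicI/= -EFinM mulrACA.
Qed.

Context d (Om : measurableType d) (P : probability Om R).
Context (X : T -> {RV P >-> R}) (theta : {fset T} -> R).
Hypothesis ecf : is_ECF X theta.

Let below (K : {fset T}) (x : R) : set Om := [set w | {in K, forall t, X t w <= x}].

Let measurable_below K x : measurable (below K x).
Proof.
apply: (@measurable_in_seq _ _ _ (enum_fset K) (fun t => [set w | X t w <= x])).
by move=> t _; exact: measurable_Xle.
Qed.

Lemma ECF_prob K x : 0 < x -> P (below K x) = (expR (- (x^-1 * theta K)))%:E.
Proof.
move=> x0; have [theta0 thetaE] := ecf.
have [->|K0] := eqVneq K fset0.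
  rewrite theta0 mulr0 oppr0 expR0 -(probability_setT P); congr (P _).
  by apply/seteqP; split.
have := thetaE K x K0 x0.
have -> : [set w | (\big[maxe/-oo]_(t <- K) (X t w)%:E <= x%:E)%E] = below K x.
  by apply/seteqP; split=> w /=; move/bigmaxe_le.
have /fineK <- := fin_num_measure P _ (measurable_below K x).
move: (fine _) => p.
(* A vanishing probability would make the right-hand side infinite, whereas [theta K] is real. *)
have [p0|p0] := leP p 0; rewrite /= ?p0 ?leNgt ?p0/=.
  by rewrite gt0_muleNy.
move=> [->]; rewrite mulrN mulrA mulVf ?gt_eqF// mul1r opprK.
by rewrite lnK// posrE.
Qed.

(** The upper bound compares [expR (- u) * (1 + u) <= 1] with
    [(1 - u + u ^+ 2) * (1 + u) = 1 + u ^+ 3]. *)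
Lemma expRN_bounds (u : R) : 0 <= u -> 0 <= expR (- u) - 1 + u <= u ^+ 2.
Proof.
move=> u0; have h1 := expR_ge1Dx (- u); have h2 := expR_ge1Dx u.
apply/andP; split; first by lra.
have : expR (- u) * (1 + u) <= 1.
  by rewrite expRN mulrC ler_pdivrMr ?expR_gt0// mul1r.
have : 0 <= expR (- u) by exact: expR_ge0.
set v := expR (- u) => v0 vu.
have : v * (1 + u) <= (1 - u + u ^+ 2) * (1 + u) by nra.
by rewrite ler_pM2r; lra.
Qed.

(* For every [x], [K |-> 1 - expR (- theta K / x)] is negative definite by
   [gram_indic_ge0]; multiply by [x] and let [x] tend to infinity. *)
Lemma ECF_negative_definite : negative_definite theta.
Proof.
move=> n K a n2 a0.
have theta_ge0 L : 0 <= theta L.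
  have := probability_le1 P (measurable_below L 1).
  by rewrite ECF_prob// invr1 mul1r lee_fin -expR0 ler_expR oppr_le0.
(* [C] collects the second-order errors in [hP], where [h] plays the role of the inverse level. *)
pose C := \sum_(j < n) \sum_(k < n) `|a j * a k| * theta (K j `|` K k)%fset ^+ 2.
have C0 : 0 <= C.
  by do 2!apply: sumr_ge0 => ? _; rewrite mulr_ge0// sqr_ge0.
apply/ler_addgt0Pr => e e0; rewrite add0r.
have hP h : 0 < h ->
    \sum_(j < n) \sum_(k < n) a j * a k * theta (K j `|` K k)%fset <= h * C.
  move=> h0.
  have gram : 0 <= \sum_(j < n) \sum_(k < n)
      a j * a k * expR (- (h * theta (K j `|` K k)%fset)).
    have := @gram_indic_ge0 _ _ P n (fun j => below (K j) h^-1) a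
      (fun j => measurable_below _ _).
    congr (_ <= _); apply: eq_bigr => j _; apply: eq_bigr => k _.
    have -> : below (K j) h^-1 `&` below (K k) h^-1 = below (K j `|` K k)%fset h^-1.
      apply/seteqP; split=> w.
        by move=> [wj wk] t; rewrite in_fsetU => /orP[]; [exact: wj|exact: wk].
      by move=> wjk; split=> t tK; apply: wjk; rewrite in_fsetU tK ?orbT.
    by rewrite ECF_prob ?invr_gt0// invrK.
  have sum0 : \sum_(j < n) \sum_(k < n) a j * a k = 0.
    by under eq_bigr do rewrite -mulr_sumr; rewrite -mulr_suml a0 mul0r.
  rewrite -(ler_pM2l h0) mulrCA; apply: le_trans (_ : _ <= \sum_(j < n) \sum_(k < n)
    (a j * a k - a j * a k * expR (- (h * theta (K j `|` K k)%fset)) +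
     h * h * (`|a j * a k| * theta (K j `|` K k)%fset ^+ 2))) _.
    rewrite mulr_sumr; apply: ler_sum => j _; rewrite mulr_sumr; apply: ler_sum => k _.
    set b := a j * a k; set v := theta _; have v0 : 0 <= v by exact: theta_ge0.
    have u0 : 0 <= h * v by rewrite mulr_ge0// ltW.
    have /andP[l1 l2] := expRN_bounds u0.
    have -> : h * (b * v) = b * (h * v) by ring.
    have -> : h * h * (`|b| * v ^+ 2) = `|b| * (h * v) ^+ 2 by ring.
    rewrite -subr_ge0.
    have -> : b - b * expR (- (h * v)) + `|b| * (h * v) ^+ 2 - b * (h * v) =
      `|b| * (h * v) ^+ 2 - b * (expR (- (h * v)) - 1 + h * v) by ring.
    rewrite subr_ge0; apply: (le_trans (ler_norm _)); rewrite normrM.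
    by rewrite ler_wpM2l// ger0_norm.
  apply: (@le_trans _ _ (\sum_(j < n) \sum_(k < n) a j * a k -
      \sum_(j < n) \sum_(k < n)
        a j * a k * expR (- (h * theta (K j `|` K k)%fset)) + h * h * C)).
    rewrite /C mulr_sumr -sumrB -big_split/=; apply: ler_sum => j _.
    by rewrite mulr_sumr -sumrB -big_split.
  by rewrite sum0 sub0r mulrA gerDr oppr_le0.
apply: le_trans (hP (e / (C + 1)) _) _; first by rewrite divr_gt0//; lra.
by rewrite mulrAC ler_pdivrMr ?ler_wpM2l ?(ltW e0)//; lra.
Qed.

End necessity.

Theorem theorem8 (R : realType) (T : choiceType) :
  (forall theta : {fset T} -> R,
    (exists (d : measure_display) (Om : measurableType d)
            (P : probability Om R) (X : T -> {RV P >-> R}),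
       simple_max_stable X /\ is_ECF X theta) <->
    [/\ negative_definite theta,
        theta fset0 = 0 &
        forall t : T, theta [fset t]%fset = 1])
  /\
  (forall theta : {fset T} -> R,
    negative_definite theta ->
    theta fset0 = 0 ->
    (forall t : T, theta [fset t]%fset = 1) ->
    (forall (M L : {fset T}) (s : seq T),
       L != fset0 -> (L `<=` M)%fset -> uniq s -> s =i L ->
       tau theta M L = - Delta_seq s theta (M `\` L)%fset /\
       tau theta M L =
         \sum_(I <- fpowerset L)
            (-1) ^+ (#|` I|%fset).+1 * theta ((M `\` L) `|` I)%fset)
    /\
    (forall N : forall M : {fset T}, (M -> R) -> R,
       (forall M : {fset T}, M != fset0 -> is_norm (N M)) ->
       exists (d : measure_display) (Om : measurableType d)
              (P : probability Om R) (X : T -> {RV P >-> R}),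
         [/\ simple_max_stable X,
             forall M : {fset T}, M != fset0 ->
               exists H : {finite_measure set (RM M) -> \bar R},
                 (forall B : set (RM M), measurable B ->
                    H B = Hstar theta (N M) B) /\
                 is_spectral_measure X (N M) H,
             forall (M : {fset T}) (x : M -> R), M != fset0 ->
               (forall t : M, 0 < x t) ->
               (- lne (P [set w | forall t : M, (X (val t) w <= x t)%R]) =
                (\sum_(L <- fpowerset M | L != fset0)
                   tau theta M L *
                   \big[Num.max/0]_(t : M | val t \in L) (x t)^-1)%:E)%E &
             is_ECF X theta])).
Proof.
split=> theta.
  split=> [[d [Om [P [X [[X_cdf _] ecf]]]]]|[ndt theta0 theta1]].
    split; [exact: (ECF_negative_definite ecf)|exact: ecf.1|move=> t].
    (* At level 1 the coefficient of a singleton is compared with the Frechet marginal. *)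
    have := ECF_prob ecf [fset t]%fset (@ltr01 R).
    rewrite invr1 mul1r => Pt; have := X_cdf t 1 ltr01.
    rewrite /cdf /distribution /pushforward invr1 => Pt'.
    have : (expR (- theta [fset t]%fset))%:E = (expR (- 1))%:E :> \bar R.
      rewrite -Pt -Pt'; congr (P _); apply/seteqP; split=> w /=.
        by rewrite in_itv/=; apply; rewrite in_fset1.
      by rewrite in_itv/= => Xw s; rewrite in_fset1 => /eqP ->.
    by move=> [/expR_inj/oppr_inj].
  have [d [Om [P [X XP]]]] := exponent_process ndt theta0 theta1.
  exists d, Om, P, X; split; first exact: has_exponent_simple_max_stable XP theta0 theta1.
  exact: has_exponent_is_ECF XP theta0.
move=> ndt theta0 theta1; split=> [M L s _ _|N normN]; first exact: tau_alt_sumE.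
(* The process is built without the norms; only the spectral measures depend on [N]. *)
have [d [Om [P [X XP]]]] := exponent_process ndt theta0 theta1.
exists d, Om, P, X; split.
- exact: has_exponent_simple_max_stable XP theta0 theta1.
- by move=> M M0; exact: (exists_spectral_measure (normN M M0) ndt XP).
- by move=> M x _ x0; exact: has_exponent_fset.
- exact: has_exponent_is_ECF XP theta0.
Qed.
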